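(* Let $f$ be a measurable function supported in a closed ball $B\subsetneq\mathbb{R}^d$. Then $M(f)\in L_{\Psi}(B)$ if, and only if, $f\in L\log\log L(B)$.
   Context: For a locally integrable function $f\colon\mathbb{R}^d\to\mathbb{C}$, the Hardy-Littlewood maximal function is $M(f)(x):=\sup_{r>0}\frac{1}{|B(x,r)|}\int_{B(x,r)}|f(y)|\,dy$, $x\in\mathbb{R}^d$, where $B(x,r)$ denotes the open ball in $\mathbb{R}^d$ centered at $x$ with radius $r>0$, and $|A|$ denotes the Lebesgue measure of $A\subseteq\mathbb{R}^d$. $\Psi\colon\mathbb{R}^d\times[0,\infty)\to[0,\infty)$ is the function $\Psi(x,t):=\dfrac{t}{\log(e+t)+\log(e+|x|)}$. If $B$ is a subset of $\mathbb{R}^d$, $L_{\Psi}(B)$ is the space of all locally integrable functions $g$ on $B$ satisfying $\int_B\Psi(x,|g(x)|)\,dx<\infty$. $\log^+|x|:=\max\{\log|x|,0\}$. Given a measurable subset $B$ of $\mathbb{R}^d$, $L\log\log L(B)$ denotes the class of all locally integrable functions $f$ with $\mathrm{supp}(f)\subseteq B$ and $\int_B|f(x)|\log^+\log^+|f(x)|\,dx<\infty$.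
   Formalization: Here L_Ψ(B) consists of measurable, a.e. finite g on B with ∫_B Ψ(x,|g|)dx<∞; local integrability of g is dropped, since with it ''if'' fails: f=|x|^{-d}(log 1/|x|)^{-2} on |x|<1/4 is in L log log L, but M(f) is not locally integrable. *)

(* Defs.v *)
From HB Require Import structures.
From mathcomp Require Import all_boot all_order all_algebra.
From mathcomp Require Import all_classical all_reals all_analysis.
From mathcomp Require Import measurable_realfun.
From mathcomp Require Import complex.

Set Implicit Arguments.
Unset Strict Implicit.
Unset Printing Implicit Defensive.

Import Order.TTheory GRing.Theory Num.Theory.
Import numFieldNormedType.Exports.

Local Open Scope classical_set_scope.
Local Open Scope ring_scope.

(* [R^d] with [d >= 1] is ['rV[R]_n.+1] where [d = n.+1].  The norm that the
   library puts on row vectors is the sup norm: it is used here only through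
   the topology that it induces. *)

Section lebesgue_measure_rV.
Context {R : realType} {n : nat}.
Local Notation E := 'rV[R]_n.+1.
Local Open Scope ereal_scope.

Definition box (a b : E) : set E :=
  [set x | forall i, (a 0%R i < x 0%R i <= b 0%R i)%R].

Definition box_volume (a b : E) : R :=
  (\prod_i Num.max 0 (b 0 i - a 0 i))%R.

Definition box_cover (A : set E) : set (E * E)^nat :=
  [set F | A `<=` \bigcup_k box (F k).1 (F k).2].

Definition lebesgue_outer_rV (A : set E) : \bar R :=
  ereal_inf [set \sum_(k <oo) (box_volume (F k).1 (F k).2)%:E
            | F in box_cover A].

Lemma box_volume_ge0 a b : (0 <= box_volume a b)%R.
Proof.
by rewrite /box_volume; apply: prodr_ge0 => i _; rewrite le_max lexx.
Qed.

Let vol (ab : E * E) : \bar R := (box_volume ab.1 ab.2)%:E.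

Let vol_ge0 ab : 0 <= vol ab.
Proof. by rewrite lee_fin box_volume_ge0. Qed.

Lemma lebesgue_outer_rV_ge0 A : 0 <= lebesgue_outer_rV A.
Proof.
apply: le_ereal_inf_tmp => _ [F _ <-]; apply: nneseries_ge0 => k *.
exact: (vol_ge0 (F k)).
Qed.

Lemma lebesgue_outer_rV0 : lebesgue_outer_rV set0 = 0.
Proof.
apply/eqP; rewrite eq_le lebesgue_outer_rV_ge0 andbT.
apply: ereal_inf_lbound; exists (fun=> (0%R, 0%R)) => //.
apply: eseries0 => k _ _ /=; congr EFin.
by rewrite /box_volume (bigD1 ord0)//= subrr maxxx mul0r.
Qed.

Lemma le_lebesgue_outer_rV :
  {homo lebesgue_outer_rV : A B / A `<=` B >-> A <= B}.
Proof.
move=> A B AB; apply/ereal_inf_le_tmp => _ [F BF <-].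
by exists F => //; exact: subset_trans AB BF.
Qed.

Lemma lebesgue_outer_rV_sigma_subadditive :
  sigma_subadditive lebesgue_outer_rV.
Proof.
move=> A; have [[i ioo]|] := pselect (exists i, lebesgue_outer_rV (A i) = +oo).
  rewrite (eseries_pinfty _ _ ioo) ?leey// => k _.
  by rewrite -ltNye (lt_le_trans _ (lebesgue_outer_rV_ge0 _)).
rewrite -forallNE => Aoo.
suff add2e (e : {posnum R}) : lebesgue_outer_rV (\bigcup_k A k) <=
    \sum_(i <oo) lebesgue_outer_rV (A i) + e%:num%:E.
  by apply/lee_addgt0Pr => _/posnumP[].
rewrite (le_trans _ (epsilon_trick _ _ _))//; last first.
  by move=> k; exact: lebesgue_outer_rV_ge0.
pose P k (F : (E * E)^nat) := box_cover (A k) F /\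
  \sum_(j <oo) vol (F j) <=
    lebesgue_outer_rV (A k) + (e%:num / (2 ^ k.+1)%:R)%:E.
have [G PG] : {G : ((E * E)^nat)^nat & forall k, P k (G k)}.
  apply: (@choice _ _ P) => k; rewrite /P /lebesgue_outer_rV.
  set S := (X in ereal_inf X); move infS : (ereal_inf S) => iS.
  case: iS infS => [r Sr|Soo|Soo].
  - have en1 : (0 < e%:num / (2 ^ k.+1)%:R)%R by [].
    have /(lb_ereal_inf_adherent en1) : ereal_inf S \is a fin_num by rewrite Sr.
    move=> [x [F AF volFx] xS].
    by exists F; split => //; rewrite /vol volFx -Sr; exact/ltW.
  - by have := Aoo k; rewrite /lebesgue_outer_rV Soo.
  - by have := lebesgue_outer_rV_ge0 (A k); rewrite /lebesgue_outer_rV Soo.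
apply: (@le_trans _ _ (\esum_(i in setT) (vol \o uncurry G) i)).
  apply: ereal_inf_lbound => /=.
  have /card_esym/ppcard_eqP[f] := card_nat2.
  exists (uncurry G \o f).
    move=> t [i _ /((PG i).1)[j _ Bijt]].
    by exists (f^-1%FUN (i, j)) => //=; rewrite invK ?inE.
  rewrite -(esum_pred_image (vol \o uncurry G) _ xpredT) ?[fun=> _]set_true//.
    by rewrite image_eq.
  by move=> ? ?; exact: vol_ge0.
rewrite (_ : esum _ _ = \sum_(i <oo) \sum_(j <oo) vol (G i j)); last first.
  pose J : nat -> set (nat * nat) := fun i => [set (i, j) | j in setT].
  rewrite (_ : setT = \bigcup_k J k); last first.
    by rewrite predeqE => -[a b]; split => // _; exists a => //; exists b.
  rewrite esum_bigcupT /=; last 2 first.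
    - apply/trivIsetP => i j _ _ ij.
      rewrite predeqE => -[k m] /=; split => //= -[] [_] _ [<-{k} _].
      by move=> [m' _] [] /esym/eqP; rewrite (negbTE ij).
    - by move=> ij; exact: vol_ge0.
  rewrite -(image_id [set: nat]) -fun_true esum_pred_image//; last first.
    by move=> k _; apply: esum_ge0 => ? _; exact: vol_ge0.
  apply: eq_eseriesr => /= j _.
  rewrite -(esum_pred_image (vol \o uncurry G) (pair j) predT)//=.
  - by congr esum; rewrite predeqE => -[a b]; split; move=> [i _ <-]; exists i.
  - by move=> ? ? _ _; exact: (@can_inj _ _ _ snd).
apply: lee_nneseries => k *; first by apply: nneseries_ge0 => *; exact: vol_ge0.
exact: (PG k).2.
Qed.

HB.instance Definition _ := isOuterMeasure.Build R E lebesgue_outer_rV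
  lebesgue_outer_rV0 lebesgue_outer_rV_ge0 le_lebesgue_outer_rV
  lebesgue_outer_rV_sigma_subadditive.

End lebesgue_measure_rV.

(* [R^d] equipped with the sigma-algebra of Lebesgue measurable sets (the
   Caratheodory sets of the Lebesgue outer measure), and Lebesgue measure. *)
Notation lebesgue_rV R n := (caratheodory_type (@lebesgue_outer_rV R n)).
Definition lebesgue_measure_rV {R : realType} {n : nat} :
  set (lebesgue_rV R n) -> \bar R := @lebesgue_outer_rV R n.

HB.instance Definition _ (R : realType) (n : nat) :=
  Measure.copy (@lebesgue_measure_rV R n)
    ((@lebesgue_outer_rV R n : {outer_measure set 'rV[R]_n.+1 -> \bar R})
      : set (lebesgue_rV R n) -> \bar R).

Section maximal_function.
Context {R : realType} {n : nat}.
Local Notation E := 'rV[R]_n.+1.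
Local Notation X := (lebesgue_rV R n).
Local Notation mu := (@lebesgue_measure_rV R n).
Local Open Scope ereal_scope.
Implicit Types (x c : E) (r t : R) (B : set E) (f : E -> R[i]).

Definition enorm x : R := Num.sqrt (\sum_i x 0 i ^+ 2)%R.

Definition open_eball c r : set E := [set x | (enorm (x - c) < r)%R].

Definition closed_eball c r : set E := [set x | (enorm (x - c) <= r)%R].

Definition cmeasurable f : Prop :=
  measurable_fun [set: X] (fun x : X => complex.Re (f x)) /\
  measurable_fun [set: X] (fun x : X => complex.Im (f x)).

Definition cabs f x : R := Normc.normc (f x).

Definition supp f : set E := closure [set x | f x != 0%R].

Definition clocally_integrable f : Prop :=
  cmeasurable f /\
  forall K : set E, compact K -> \int[mu]_(x in K) (cabs f x)%:E < +oo.

(* Extended-real valued, so that it makes sense for any measurable [f]: it is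
   identically [+oo] when [f] is supported in a ball and not integrable. *)
Definition maximal f x : \bar R :=
  ereal_sup [set (mu (open_eball x r))^-1 *
                 \int[mu]_(y in open_eball x r) (cabs f y)%:E
            | r in [set r : R | (0 < r)%R]].

Definition Psi x t : R := (t / (ln (expR 1 + t) + ln (expR 1 + enorm x)))%R.

(* The values [+oo] and [-oo] are allowed on a null set, where [fine] sends them
   to [0].  Local integrability of [g] is not part of the definition: on a ball
   [B], [maximal f] is integrable only if [f] is in the smaller class
   [L log L]. *)
Definition L_Psi B (g : E -> \bar R) : Prop :=
  [/\ measurable_fun (B : set X) (g : X -> \bar R),
      {ae mu, forall x : X, B x -> g x \is a fin_num} &
      \int[mu]_(x in B) (Psi x (fine `|g x|))%:E < +oo].

(* [ln] is [0] on nonpositive reals, so [logp 0 = 0] as it should. *)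
Definition logp t : R := Num.max (ln `|t|) 0%R.

Definition LloglogL B f : Prop :=
  [/\ clocally_integrable f, supp f `<=` B &
      \int[mu]_(x in B) (cabs f x * logp (logp (cabs f x)))%:E < +oo].

End maximal_function.

(* Main.v *)
Require Import Defs.
From mathcomp Require Import all_boot all_order all_algebra.
From mathcomp Require Import all_classical all_reals all_analysis.
From mathcomp Require Import measurable_realfun.
From mathcomp Require Import complex.
From mathcomp Require Import ring lra.
Import Order.TTheory GRing.Theory Num.Theory.
Import numFieldNormedType.Exports.
Set Implicit Arguments.
Unset Strict Implicit.
Unset Printing Implicit Defensive.
Local Open Scope classical_set_scope.
Local Open Scope ring_scope.

(* Write [g = |f|].  Two weak-type estimates compare the distribution function
   of [M g] with the tails of [g]:
     |{M g > t}| <= C / t * \int_{g > a t} g   for all t > 0, and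
     \int_{g > t} g <= C t |{x in B : M g x > l t}|   for t large;
   both come from Vitali's covering lemma, applied to sup-norm balls since these
   are comparable with Euclidean balls.  In the second one, the covering balls
   have their centres in [B] and radius at most the diameter of [B], so that a
   fixed proportion of each of them lies inside [B].  Taking t = 2 ^ k and
   summing over k with weights 2 ^ k / k turns the left-hand side into the
   integral of Psi(., M g), because t / log (e + t) is comparable to the sum of
   the 2 ^ k / k with 2 ^ k < t, and the right-hand side into the integral of
   g log log g, because log log t is comparable to the sum of the 1 / k with
   2 ^ k < t. *)

(** Both weak-type estimates assume that [g] has finite integral: Vitali's lemma needs bounded
    radii, and the total mass of [g] is what bounds them. In one direction this integrability is
    part of [LloglogL]; in the other it has to be extracted from a single point of [B] at which the
    maximal function is finite. The reverse estimate holds only for large [t] because the stopping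
    radius, nearly the largest one for which the average exceeds a small multiple of [t], must stay
    below the diameter of [B]. The finitely many dyadic levels lost in this way cost a multiple of
    the integral of [g]. All constants may be crude, so a density argument that loses a fixed factor
    suffices to start the stopping-time selection at almost every point. Infinite values of the
    maximal function count as [0] in the integral of [Psi]. This is harmless when that integral is
    bounded from above, but almost everywhere finiteness is needed when it serves as an upper bound.
    The term [log (e + |x|)] is bounded on [B] and costs only a constant. *)

Lemma emeasurable_nneseries d (T : measurableType d) (R : realType) (D : set T)
    (h : nat -> T -> \bar R) : (forall k x, 0 <= h k x)%E ->
  (forall k, measurable_fun D (h k)) ->
  measurable_fun D (fun x => \sum_(k <oo) h k x)%E.
Proof.
move=> h0 mh; have := @ge0_emeasurable_sum d T R D h xpredT.
by apply => [k x _ _|k _]; [exact: h0|exact: mh].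
Qed.

(** * Lebesgue measure on row vectors *)

Section lebesgue_rV_theory.
Context {R : realType} {n : nat}.
Local Notation E := 'rV[R]_n.+1.
Local Notation X := (lebesgue_rV R n).
Local Notation mu := (@lebesgue_measure_rV R n).
Local Open Scope ereal_scope.
Implicit Types (A U N : set E) (a b v c x : E) (s r t : R).

Lemma mu_le_cover A (F : (E * E)^nat) : box_cover A F ->
  mu A <= \sum_(k <oo) (box_volume (F k).1 (F k).2)%:E.
Proof. by move=> AF; apply: ereal_inf_lbound; exists F. Qed.

Lemma mu_ge_cover A (l : \bar R) :
  (forall F, box_cover A F ->
    l <= \sum_(k <oo) (box_volume (F k).1 (F k).2)%:E) -> l <= mu A.
Proof. by move=> h; apply: le_ereal_inf_tmp => _ [F AF <-]; exact: h. Qed.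

Lemma box_volumeE0 x : box_volume x x = 0%R.
Proof. by rewrite /box_volume (bigD1 ord0)//= subrr maxxx mul0r. Qed.

Lemma mu_box_le a b : mu (box a b) <= (box_volume a b)%:E.
Proof.
pose F k : E * E := if k is 0%N then (a, b) else (0%R, 0%R).
apply: (@le_trans _ _ (\sum_(k <oo) (box_volume (F k).1 (F k).2)%:E)).
  by apply: mu_le_cover => x bx; exists 0%N.
rewrite nneseries_recl//; last by move=> *; rewrite lee_fin box_volume_ge0.
rewrite eseries_cond eseries0 ?adde0// => -[|k]//= _ _.
by rewrite box_volumeE0.
Qed.

(** The cut is along the hyperplane [x_i = t]. Because side lengths are truncated at [0], the
    identity also covers empty boxes and hyperplanes that miss the box, so no case distinction is
    left to its users. *)
Lemma box_volume_split i t a b :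
  (box_volume a b = box_volume a (\row_j (if j == i then Num.min (b 0 j) t else b 0 j))
    + box_volume (\row_j (if j == i then Num.max (a 0 j) t else a 0 j)) b)%R.
Proof.
rewrite /box_volume (bigD1 i)//= [in RHS](bigD1 i)//=.
rewrite [X in (_ = _ + X)%R](bigD1 i)//= !mxE eqxx.
under [in RHS]eq_bigr => j /negbTE ji do rewrite mxE ji.
under [X in (_ = _ + _ * X)%R]eq_bigr => j /negbTE ji do rewrite mxE ji.
rewrite -mulrDl; congr (_ * _)%R.
rewrite /Num.min /Num.max.
by repeat case: ifPn => //; lra.
Qed.

(** Cutting every box of a cover of [A] gives covers of the two parts of [A] with the same total
    volume, which is the Caratheodory inequality. *)
Lemma measurable_halfspace i t : measurable ([set x | (x 0 i <= t)%R] : set X).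
Proof.
apply: le_caratheodory_measurable => A.
apply: mu_ge_cover => F AF.
pose F1 k : E * E := ((F k).1, \row_j (if j == i then Num.min ((F k).2 0 j) t
  else (F k).2 0 j)%R).
pose F2 k : E * E := (\row_j (if j == i then Num.max ((F k).1 0 j) t
  else (F k).1 0 j)%R, (F k).2).
under eq_eseriesr => k _ do rewrite (box_volume_split i t) EFinD.
rewrite nneseriesD; [|by move=> k _ _; rewrite lee_fin box_volume_ge0..].
apply: leeD.
- apply: (@mu_le_cover _ F1) => x [/AF[k _ Fkx] xt].
  exists k => // j; rewrite mxE; case: eqVneq => [->|//].
  by rewrite le_min xt andbT; exact: Fkx.
- apply: (@mu_le_cover _ F2) => x [/AF[k _ Fkx] /= xt].
  exists k => // j; rewrite mxE; case: eqVneq => [->|//].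
  rewrite gt_max; have /andP[-> ->] := Fkx i.
  by rewrite ltNge andbT; exact/negP.
Qed.

Lemma measurable_coord i : measurable_fun setT (fun x : X => (x : E) 0%R i).
Proof.
apply: (measurability _ (RGenInftyO.measurableE R)) => _ [_ [t ->] <-].
rewrite setTI (_ : _ @^-1` _ = \bigcup_k [set x : E | (x 0 i <= t - k.+1%:R^-1)%R]).
  by apply: bigcup_measurable => k _; exact: measurable_halfspace.
apply/seteqP; split => x /=; rewrite in_itv/=.
  rewrite -subr_gt0 => /ltr_add_invr[k]; rewrite add0r => kx.
  by exists k => //=; rewrite lerBrDl -lerBrDr ltW.
by move=> [k _ /=] /le_lt_trans; apply; rewrite ltrBlDr ltrDl.
Qed.

Lemma measurable_enorm c : measurable_fun setT (fun x : X => enorm ((x : E) - c)).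
Proof.
rewrite /enorm; apply: (measurableT_comp (f := @Num.sqrt R)).
  by apply: continuous_measurable_fun; exact: sqrt_continuous.
apply: measurable_sum => i.
under eq_fun do rewrite !mxE.
apply: measurable_funX; apply: measurable_funB; last exact: measurable_cst.
exact: measurable_coord.
Qed.

Lemma ballrVE c r : (0 < r)%R -> ball c r =
  [set x : E | forall i, (`|c 0 i - x 0 i| < r)%R].
Proof.
move=> r0; apply/seteqP; split => x /=.
  by move=> [_ h] i; exact: h.
by move=> h; split => // j i; rewrite [j]ord1; exact: h.
Qed.

Lemma ballrV_le0 c r : (r <= 0)%R -> ball c r = set0.
Proof.
move=> r0; rewrite -subset0 => x [] /=.
by rewrite ltNge r0.
Qed.

Lemma measurable_ballrV c r : measurable (ball c r : set X).
Proof.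
have [r0|/ballrV_le0->//] := ltP 0%R r.
rewrite (ballrVE _ r0) (_ : [set _ | _] =
    \bigcap_(i in [set: 'I_n.+1]) [set x : E | (`|c 0 i - x 0 i| < r)%R]); last first.
  by apply/seteqP; split => x /= h i => [_|]; exact: h.
apply: fin_bigcap_measurable => // i _.
rewrite -[X in measurable X]setTI.
have : measurable_fun [set: X] (fun x : X => `|c 0 i - (x : E) 0 i|%R).
  apply: (measurableT_comp (f := @Num.norm R R)); first exact: normr_measurable.
  by apply: measurable_funB; [exact: measurable_cst|exact: measurable_coord].
move=> /(_ measurableT `]-oo, r[%classic (measurable_itv _)).
by congr (measurable (_ `&` _)); apply/seteqP; split => x /=; rewrite in_itv.
Qed.

Lemma ex_rat_ball c r : (0 < r)%R -> exists q : 'rV[rat]_n.+1,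
  ball c r (map_mx ratr q : E).
Proof.
move=> r0.
have h i : exists q : rat, (`|c 0 i - ratr q| < r)%R.
  have : (c 0 i - r < c 0 i + r)%R by lra.
  move=> /rat_in_itvoo[q]; rewrite in_itv/= => /andP[h1 h2].
  by exists q; rewrite ltr_norml; lra.
have [q hq] := choice h.
exists (\row_i q i); rewrite ballrVE// => i /=; rewrite !mxE; exact: hq.
Qed.

(** [U] is the union of those balls with rational centre and radius [1 / (k + 1)] that it contains,
    and there are countably many of them. *)
Lemma open_measurable_rV U : open U -> measurable (U : set X).
Proof.
move=> oU.
pose B (p : 'rV[rat]_n.+1 * nat) : set E :=
  let b := ball (map_mx ratr p.1 : E) (p.2.+1%:R^-1) in if `[< b `<=` U >] then b else set0.
rewrite (_ : U = \bigcup_p B p); last first.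
  apply/seteqP; split => [x Ux|x [p _]]; last first.
    by rewrite /B /=; case: ifPn => // /asboolP h /h.
  have : nbhs x U by exact: open_nbhs_nbhs.
  move=> /nbhs_ballP[e /= e0 eU].
  have /ltr_add_invr[k] : (0 < e / 2)%R by rewrite divr_gt0.
  rewrite add0r => ke.
  have [|q xq] := @ex_rat_ball x (k.+1%:R^-1); first by rewrite invr_gt0.
  exists (q, k) => //; rewrite /B /=; case: asboolP => [_|]; first exact: ball_sym.
  case=> y qy; apply: eU; apply: le_ball (ball_triangle xq qy).
  by rewrite (splitr e) lerD// ltW.
apply: countable_bigcupT_measurable; first exact: countableP.
move=> p; rewrite /B/=; case: ifPn => // _.
exact: measurable_ballrV.
Qed.

Definition dilation v s : E -> E := fun x => (v + s *: x)%R.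

Lemma mu_dilation_le v s A : (0 < s)%R ->
  mu (dilation v s @` A) <= (s ^+ n.+1)%:E * mu A.
Proof.
move=> s0; have sn0 : (0 < s ^+ n.+1)%R by rewrite exprn_gt0.
rewrite -lee_pdivrMl//; apply: mu_ge_cover => F AF.
rewrite lee_pdivrMl// -nneseriesZl; last by move=> k _; rewrite lee_fin box_volume_ge0.
pose G k := (dilation v s (F k).1, dilation v s (F k).2).
rewrite (_ : (fun _ => _) = fun k => \sum_(0 <= i < k) (box_volume (G i).1 (G i).2)%:E).
  apply: mu_le_cover => _ [x /AF[k _ Fkx] <-]; exists k => // i.
  by rewrite /= /dilation !mxE ltrD2l ltr_pM2l// lerD2l ler_pM2l.
apply/funext => k; apply: eq_bigr => i _; rewrite -EFinM; congr EFin.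
rewrite /box_volume -[X in (s ^+ X)%R](card_ord n.+1) -prodr_const -big_split/=.
apply: eq_bigr => j _; rewrite /dilation !mxE.
by rewrite maxr_pMr ?ltW// mulr0; congr Num.max; ring.
Qed.

Lemma mu_dilation v s A : (0 < s)%R ->
  mu (dilation v s @` A) = (s ^+ n.+1)%:E * mu A.
Proof.
move=> s0; apply/eqP; rewrite eq_le mu_dilation_le//=.
have sn0 : (0 < s ^+ n.+1)%R by rewrite exprn_gt0.
(* The reverse inequality is the one already proved, applied to the inverse dilation. *)
have /(mu_dilation_le (- (s^-1 *: v))%R (dilation v s @` A)) :
  (0 < s^-1)%R by rewrite invr_gt0.
rewrite exprVn -lee_pdivrMl ?invr_gt0// invrK; apply: le_trans.
rewrite lee_pmul2l ?lte_fin// [leRHS](_ : _ = mu A)//.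
congr mu; rewrite image_comp (_ : _ \o _ = id) ?image_id//.
apply/funext => x; rewrite /dilation/= scalerDr scalerA mulVf ?gt_eqF// scale1r.
by rewrite addrA addNr add0r.
Qed.

Let unit_box : set E := box 0%R (const_mx 1%R).

(* A cover of the unit box by boxes gives [1 <= \sum_k \1_(box k) x] on the unit
   box; integrating over one coordinate at a time replaces each indicator by the
   volume of the box. *)
Lemma mu_unit_box_ge1 : 1 <= mu unit_box.
Proof.
apply: mu_ge_cover => F UF.
pose len k (i : 'I_n.+1) : R := Num.max 0%R ((F k).2 0 i - (F k).1 0 i)%R.
pose ind k (i : 'I_n.+1) (y : R) : R := (\1_(`](F k).1 0 i, (F k).2 0 i]%classic) y)%R.
(* In [W j k] the first [j] coordinates are integrated out: [W 0 k] is the indicator of the [k]-th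
   box and [W n.+1 k] its volume. The lower bound [1] for the sum over [k] is propagated by
   induction on [j]. *)
pose W j k x : R := (\prod_(i < n.+1) (if (i < j)%N then len k i else ind k i (x 0 i)))%R.
have len0 k i : (0 <= len k i)%R by rewrite le_max lexx.
have ind0 k i y : (0 <= ind k i y)%R by rewrite /ind.
have W0 j k x : (0 <= W j k x)%R by apply: prodr_ge0 => i _; case: ifP.
suff key j : (j <= n.+1)%N -> forall x, unit_box x ->
    1 <= \sum_(k <oo) (W j k x)%:E.
  have u1 : unit_box (const_mx 1%R) by move=> i; rewrite !mxE ltr01 lexx.
  apply: le_trans (key _ (leqnn _) _ u1) _.
  apply: lee_nneseries => [k _ _|k _]; first by rewrite lee_fin.
  by rewrite lee_fin /W; under eq_bigr do rewrite ltn_ord.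
elim: j => [_ x /UF[k _ Fkx]|j ih jn x ux].
  apply: (@le_trans _ _ (W 0%N k x)%:E).
    rewrite lee_fin /W big1// => i _ /=.
    by rewrite /ind indicE mem_set//= in_itv/=; exact: Fkx.
  rewrite (@nneseriesD1 _ _ k)//; last by move=> m _; rewrite lee_fin.
  by apply: leeDl; apply: nneseries_ge0 => m _ _; rewrite lee_fin.
pose J := Ordinal jn.
pose C k : R := (\prod_(i < n.+1 | i != J) (if (i < j)%N then len k i else ind k i (x 0 i)))%R.
have C0 k : (0 <= C k)%R by apply: prodr_ge0 => i _; case: ifP.
have WS k : W j.+1 k x = (C k * len k J)%R.
  rewrite /W (bigD1 J)//= ltnSn mulrC; congr (_ * _)%R.
  apply: eq_bigr => i iJ; rewrite ltnS leq_eqVlt (_ : (i == j :> nat) = false)//.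
  by apply/negbTE; move: iJ; apply: contra => /eqP ij; apply/eqP/val_inj.
pose x' (y : R) : E := (\row_i (if i == J then y else x 0 i))%R.
have Wx' k y : W j k (x' y) = (C k * ind k J y)%R.
  rewrite /W (bigD1 J)//= ltnn mulrC mxE eqxx; congr (_ * _)%R.
  by apply: eq_bigr => i /negbTE iJ; rewrite mxE iJ.
have mI k : measurable (`](F k).1 0%R J, (F k).2 0%R J]%classic : set R).
  exact: measurable_itv.
have mu1 : (@lebesgue_measure R) (`]0%R, 1%R]%classic) = 1.
  by rewrite lebesgue_measure_itv/= lte_fin ltr01 oppr0 adde0.
rewrite -mu1 -[leLHS]mul1e -integral_cst; last exact: measurable_itv.
apply: (@le_trans _ _ (\int[lebesgue_measure]_(y in `]0%R, 1%R])
    (\sum_(k <oo) (C k * ind k J y)%:E))).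
  apply: ge0_le_integral => //=.
  - apply: emeasurable_nneseries => [k y|k]; first by rewrite lee_fin mulr_ge0.
    apply/measurable_EFinP/measurable_funM => //.
    exact: measurable_indic.
  - move=> y; rewrite in_itv/= => y01.
    under eq_eseriesr do rewrite -Wx'.
    apply: ih; first exact: ltnW.
    by move=> i; rewrite !mxE; case: eqP => // _; have := ux i; rewrite !mxE.
rewrite integral_nneseries//=.
- apply: lee_nneseries => [k _ _|k _]; first by apply: integral_ge0 => *; rewrite lee_fin mulr_ge0.
  rewrite WS EFinM; under eq_integral do rewrite EFinM.
  rewrite ge0_integralZl_EFin//=; [|by move=> y _; rewrite lee_fin|
    by apply/measurable_EFinP; exact: measurable_indic].
  rewrite lee_wpmul2l ?lee_fin// integral_indic//.
  apply: (@le_trans _ _ (lebesgue_measure `](F k).1 0%R J, (F k).2 0%R J]%classic)).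
    by apply: le_measure => [||y []//]; rewrite inE; [exact: measurableI|exact: mI].
  rewrite lebesgue_measure_itv/= lte_fin /len.
  by case: ltP => h; rewrite -?EFinB lee_fin le_max lexx ?orbT.
- by move=> k; apply/measurable_EFinP/measurable_funM => //; exact: measurable_indic.
- by move=> k y _; rewrite lee_fin mulr_ge0.
Qed.

Definition ballc : R := fine (mu (ball (0%R : E) 1%R)).

Lemma ball_dilation c r : (0 < r)%R -> ball c r = dilation c r @` ball (0%R : E) 1%R.
Proof.
move=> r0; rewrite !ballrVE//; apply/seteqP; split => [x /= h|_ [x /= h <-] i].
  exists (r^-1 *: (x - c))%R; last first.
    by rewrite /dilation scalerA divff ?gt_eqF// scale1r addrC subrK.
  move=> i; rewrite !mxE sub0r normrN normrM gtr0_norm ?invr_gt0//.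
  by rewrite ltr_pdivrMl// mulr1 distrC.
rewrite /dilation !mxE opprD addNKr normrN normrM gtr0_norm//.
by rewrite gtr_pMr//; have := h i; rewrite mxE sub0r normrN.
Qed.

Lemma ball01_fin : mu (ball (0%R : E) 1%R) \is a fin_num.
Proof.
rewrite ge0_fin_numE//; apply: (@le_lt_trans _ _ (mu (box (const_mx (-1)%R) (const_mx 1%R)))).
  apply: le_outer_measure; rewrite ballrVE// => x h i.
  by have := h i; rewrite !mxE sub0r normrN ltr_norml => /andP[-> /ltW ->].
by apply: le_lt_trans (mu_box_le _ _) _; rewrite ltry.
Qed.

Lemma mu_ball c r : (0 <= r)%R -> mu (ball c r) = (ballc * r ^+ n.+1)%:E.
Proof.
rewrite le_eqVlt => /predU1P[<-|r0].
  by rewrite ballrV_le0// expr0n/= mulr0; exact: outer_measure0.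
by rewrite ball_dilation// mu_dilation// EFinM muleC /ballc fineK// ball01_fin.
Qed.

Lemma ballc_gt0 : (0 < ballc)%R.
Proof.
rewrite -lte_fin /ballc fineK ?ball01_fin//.
apply: lt_le_trans (le_trans mu_unit_box_ge1 _); first exact: lte01.
(* Translated so that its centre is the origin, the unit box has coordinates of modulus at most
   [1/2]. *)
have -> : mu unit_box = mu (dilation (const_mx (- 2^-1))%R 1 @` unit_box).
  by rewrite mu_dilation// expr1n mul1e.
apply: le_outer_measure; rewrite ballrVE// => _ [x ux <-] i.
rewrite /dilation !mxE mul1r sub0r normrN; have := ux i; rewrite !mxE => /andP[h1 h2].
rewrite ltr_norml; lra.
Qed.

(** Outer regularity up to the factor [2 ^ d]: each box of an almost optimal cover is widened by
    half its side on both sides. Doubling the sides, rather than adding a small margin, multiplies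
    every volume by exactly [2 ^ d] and keeps empty boxes empty. *)
Lemma mu_open_approx N (e : R) : (0 < e)%R -> mu N < +oo -> exists U,
  [/\ open U, N `<=` U & mu U <= (2 ^+ n.+1)%:E * (mu N + e%:E)].
Proof.
move=> e0 Noo.
have Nfin : mu N \is a fin_num by rewrite ge0_fin_numE//; exact: outer_measure_ge0.
have [_ [F NF <-] Fe] := lb_ereal_inf_adherent e0 Nfin.
pose G k : E * E := (((F k).1 - 2^-1 *: ((F k).2 - (F k).1))%R,
             ((F k).2 + 2^-1 *: ((F k).2 - (F k).1))%R).
pose V k : set E := [set x | forall i, ((G k).1 0 i < x 0 i < (G k).2 0 i)%R].
exists (\bigcup_k V k); split.
- apply: bigcup_open => k _; rewrite openE => x Vx.
  suff h i : \forall y \near x, ((G k).1 0%R i < (y : E) 0%R i < (G k).2 0%R i)%R.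
    exact: (@filter_forall E 'I_n.+1 _ (nbhs x) _ h).
  have /andP[h1 h2] := Vx i.
  have cx : (fun x : E => x 0%R i) @ x --> x 0%R i by exact: coord_continuous.
  near=> y; apply/andP; split.
    by near: y; exact: (cvgr_gt _ cx).
  by near: y; exact: (cvgr_lt _ cx).
- move=> x /NF[k _ h]; exists k => // i; rewrite /G/= !mxE.
  have := h i; lra.
- apply: (@le_trans _ _ (\sum_(k <oo) (box_volume (G k).1 (G k).2)%:E)).
    apply: mu_le_cover => x [k _ h]; exists k => // i.
    by have /andP[-> /ltW] := h i.
  rewrite (_ : (fun _ => _) = fun k => \sum_(0 <= i < k)
     ((2 ^+ n.+1)%:E * (box_volume (F i).1 (F i).2)%:E)); last first.
    apply/funext => k; apply: eq_bigr => i _; rewrite -EFinM; congr EFin.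
    rewrite /box_volume -[X in (2 ^+ X)%R](card_ord n.+1) -prodr_const -big_split/=.
    apply: eq_bigr => j _; rewrite !mxE.
    rewrite maxr_pMr// mulr0; congr Num.max; lra.
  rewrite nneseriesZl; last by move=> *; rewrite lee_fin box_volume_ge0.
  by rewrite lee_pmul2l ?lte_fin ?exprn_gt0//; exact: ltW.
Unshelve. all: by end_near. Qed.

End lebesgue_rV_theory.

(** * Vitali's covering lemma *)

Section vitali_covering.
Context {R : realType} {n : nat}.
Local Notation E := 'rV[R]_n.+1.
Variables (A : set E) (r : E -> R) (M : R).
Hypothesis r_gt0 : forall x, A x -> 0 < r x.
Hypothesis r_le : forall x, A x -> r x <= M.

Let B x : set E := ball x (r x).

(* Federer's argument: Zorn's lemma is applied to disjoint subfamilies such that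
   every ball of the family meeting one of their balls also meets one that is at
   least half as large. *)
Let selection (D : set E) := [/\ D `<=` A, trivIset D B &
  forall x y, A x -> D y -> B x `&` B y !=set0 ->
    exists z, [/\ D z, B x `&` B z !=set0 & r x <= 2 * r z]].

(** If some ball met no selected one, a ball of nearly maximal radius among those that meet none
    could be added to the maximal subfamily. *)
Let maximal_selection : exists D, selection D /\
  forall x, A x -> exists2 y, D y & B x `&` B y !=set0.
Proof.
have [|D [[DA tD hD] maxD]] := @Zorn_bigcup _ selection.
  move=> F Fsel Ftot; split.
  - by move=> x [D /Fsel[DA _ _] /DA].
  - move=> x y [D1 FD1 D1x] [D2 FD2 D2y].
    have [_ t1 _] := Fsel _ FD1; have [_ t2 _] := Fsel _ FD2.
    by have [D12|D21] := Ftot _ _ FD1 FD2; [apply: t2 => //; exact: D12|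
                                            apply: t1 => //; exact: D21].
  - move=> x y Ax [D FD Dy] xy; have [_ _ h] := Fsel _ FD.
    by have [z [Dz xz rxz]] := h _ _ Ax Dy xy; exists z; split => //; exists D.
exists D; split => // x0 Ax0; apply: contrapT => x0D.
pose free := [set x | A x /\ forall y, D y -> B x `&` B y = set0].
have free0 : free x0.
  split=> // y Dy; apply: contrapT => /eqP/set0P h; apply: x0D; by exists y.
have sup_free : has_sup (r @` free).
  by split; [exists (r x0), x0|exists M => _ [x [Ax _] <-]; exact: r_le].
have sup_gt0 : 0 < sup (r @` free).
  apply: lt_le_trans (r_gt0 Ax0) _; apply: ub_le_sup; [exact: sup_free.2|by exists x0].
(* The radius of [x1] exceeds half the supremum over [free], so its ball can serve as the large
   neighbour of every free ball that meets it. *)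
have [_ [x1 [Ax1 x1D] <-] x1sup] := sup_adherent (divr_gt0 sup_gt0 (ltr0Sn R 1)) sup_free.
have Bx1 : B x1 x1 by apply: ballxx; exact: r_gt0.
apply: (maxD (D `|` [set x1])).
  split; first exact: subsetUl.
  move=> /(_ x1 (or_intror erefl)) /x1D; rewrite setIid => /seteqP[/(_ x1) + _].
  exact.
split.
- by move=> x [/DA//|->].
- move=> x y [Dx|->] [Dy|->] // [w [xw yw]].
  + by apply: tD => //; exists w.
  + by have /seteqP[/(_ w) + _] := x1D _ Dx; case; split.
  + by have /seteqP[/(_ w) + _] := x1D _ Dy; case; split.
- move=> x y Ax Dy xy.
  (* A free ball can meet only the new ball, which is large enough; any other ball meets an old
     selected ball, and the property of [D] applies. *)
  have [xfree|] := pselect (free x).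
    exists x1; split; [by right| |].
    + case: Dy xy => [Dy [w xyw]|->//].
      by have /seteqP[/(_ w) + _] := xfree.2 _ Dy; case.
    + have : r x <= sup (r @` free).
        by apply: ub_le_sup; [exact: sup_free.2|by exists x].
      move: x1sup; lra.
  move=> /not_andP[//|/existsNP[y' /not_implyP[Dy' /eqP/set0P xy']]].
  by have [z [Dz xz rxz]] := hD _ _ Ax Dy' xy'; exists z; split => //; left.
Qed.

(* Radius [0] encodes an unused index: the corresponding ball is empty. *)
Lemma vitali_covering : exists (c : nat -> E) (rho : nat -> R),
  [/\ forall k, rho k = 0 \/ (A (c k) /\ rho k = r (c k)),
      trivIset setT (fun k => ball (c k) (rho k)) &
      A `<=` \bigcup_k ball (c k) (3 * rho k)].
Proof.
have [D [[DA tD hD] meetD]] := maximal_selection.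
(* Each ball contains a rational point. The selected balls are disjoint, so the code of this point
   determines the ball and enumerates the family by [nat]. *)
have /choice[q hq] x : exists q : 'rV[rat]_n.+1, A x -> B x (map_mx ratr q : E).
  have [Ax|nAx] := pselect (A x); last by exists 0.
  by have [q xq] := ex_rat_ball x (r_gt0 Ax); exists q.
have /choice[c hc] k : exists c : E * R,
    (D c.1 /\ pickle (q c.1) = k /\ c.2 = r c.1) \/
    (c.2 = 0 /\ forall x, D x -> pickle (q x) <> k).
  have [[x [Dx qx]]|nx] := pselect (exists x, D x /\ pickle (q x) = k).
    by exists (x, r x); left.
  by exists (0, 0); right; split => // x Dx qx; apply: nx; exists x.
exists (fun k => (c k).1), (fun k => (c k).2); split.
- move=> k; have [[Dc [_ ->]]|[-> _]] := hc k; [right|by left].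
  by split=> //; exact: DA.
- move=> i j _ _ [w []].
  have [[Di [qi ->]]|[-> _]] := hc i; last by rewrite ballrV_le0.
  have [[Dj [qj ->]]|[-> _]] := hc j; last by move=> _; rewrite ballrV_le0.
  move=> iw jw; rewrite -qi -qj; congr (pickle (q _)).
  by apply: tD => //; exists w.
- move=> x Ax; have [y Dy xy] := meetD _ Ax.
  have [z [Dz [w [xw zw]] rxz]] := hD _ _ Ax Dy xy.
  exists (pickle (q z)) => //.
  have [[Dc [qc ->]]|[_ /(_ z Dz)//]] := hc (pickle (q z)).
  have <- : z = (c (pickle (q z))).1.
    apply: tD => //; exists (map_mx ratr (q z) : E); split; first by apply: hq; exact: DA.
    by have := hq _ (DA _ Dc); rewrite (pcan_inj pickleK qc).
  (* Only the centre [x] has to be covered, not its ball: its distance to [z] is less than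
     [r z + r x <= 3 * r z], hence the factor [3]. *)
  rewrite (_ : 3 * r z = r z + 2 * r z); last by ring.
  by apply: le_ball (ball_triangle zw (ball_sym xw)); rewrite lerD2l.
Qed.

End vitali_covering.

(** * Euclidean balls *)

Section euclidean_norm.
Context {R : realType} {n : nat}.
Local Notation E := 'rV[R]_n.+1.
Implicit Types (x y c : E) (r s t : R).

Lemma enorm_ge0 x : 0 <= enorm x.
Proof. exact: sqrtr_ge0. Qed.

Let sqsum_ge0 x : 0 <= \sum_i x 0 i ^+ 2.
Proof. by apply: sumr_ge0 => i _; exact: sqr_ge0. Qed.

Lemma sqr_enorm x : enorm x ^+ 2 = \sum_i x 0 i ^+ 2.
Proof. by rewrite sqr_sqrtr. Qed.

Lemma coord_le_enorm x i : `|x 0 i| <= enorm x.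
Proof.
rewrite -ler_sqr ?nnegrE ?enorm_ge0// sqr_enorm real_normK ?num_real//.
by rewrite (bigD1 i)//= lerDl sumr_ge0// => j _; exact: sqr_ge0.
Qed.

(** Cauchy-Schwarz, from the nonnegative sum of the squares of [|y| x_i - |x| y_i], which equals
    [2 |x| |y| (|x| |y| - x.y)]. *)
Lemma dot_le_enorm x y : \sum_i x 0 i * y 0 i <= enorm x * enorm y.
Proof.
have [x0|x0] := eqVneq (enorm x) 0.
  rewrite x0 mul0r big1// => i _.
  by have := coord_le_enorm x i; rewrite x0 normr_le0 => /eqP ->; rewrite mul0r.
have [y0|y0] := eqVneq (enorm y) 0.
  rewrite y0 mulr0 big1// => i _.
  by have := coord_le_enorm y i; rewrite y0 normr_le0 => /eqP ->; rewrite mulr0.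
have xp : 0 < enorm x by rewrite lt_neqAle eq_sym x0 enorm_ge0.
have yp : 0 < enorm y by rewrite lt_neqAle eq_sym y0 enorm_ge0.
have h : 0 <= \sum_i (enorm y * x 0 i - enorm x * y 0 i) ^+ 2.
  by apply: sumr_ge0 => i _; exact: sqr_ge0.
have e : \sum_i (enorm y * x 0 i - enorm x * y 0 i) ^+ 2 =
    2 * (enorm x * enorm y) * (enorm x * enorm y - \sum_i x 0 i * y 0 i).
  transitivity (\sum_i (enorm y ^+ 2 * x 0 i ^+ 2 + enorm x ^+ 2 * y 0 i ^+ 2
      - 2 * (enorm x * enorm y) * (x 0 i * y 0 i))).
    by apply: eq_bigr => i _; ring.
  by rewrite sumrB big_split/= -!mulr_sumr -!sqr_enorm; ring.
move: h; rewrite e pmulr_rge0 ?subr_ge0//.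
by rewrite !mulr_gt0.
Qed.

Lemma ler_enormD x y : enorm (x + y) <= enorm x + enorm y.
Proof.
rewrite -ler_sqr ?nnegrE ?addr_ge0 ?enorm_ge0// sqr_enorm.
rewrite (_ : \sum_i _ = enorm x ^+ 2 + 2 * (\sum_i x 0 i * y 0 i) + enorm y ^+ 2).
  have := dot_le_enorm x y; nra.
rewrite !sqr_enorm mulr_sumr -!big_split/=.
by apply: eq_bigr => i _; rewrite !mxE; ring.
Qed.

Lemma enormZ s x : enorm (s *: x) = `|s| * enorm x.
Proof.
rewrite /enorm -sqrtr_sqr -sqrtrM ?sqr_ge0//; congr Num.sqrt.
by rewrite mulr_sumr; apply: eq_bigr => i _; rewrite mxE exprMn.
Qed.

Lemma enormN x : enorm (- x) = enorm x.
Proof. by rewrite -scaleN1r enormZ normrN1 mul1r. Qed.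

Lemma enorm_le_coord x r : (forall i, `|x 0 i| <= r) -> enorm x <= n.+1%:R * r.
Proof.
move=> h; have r0 : 0 <= r by exact: le_trans (h 0).
rewrite -ler_sqr ?nnegrE ?enorm_ge0 ?mulr_ge0// sqr_enorm.
apply: (@le_trans _ _ (\sum_(i < n.+1) r ^+ 2)).
  by apply: ler_sum => i _; rewrite -real_normK ?num_real// lerXn2r ?nnegrE.
rewrite sumr_const card_ord exprMn -[leLHS]mulr_natl ler_wpM2r ?sqr_ge0//.
by rewrite -natrX ler_nat leq_pmulr.
Qed.

Lemma eball_sub_ball c r : open_eball c r `<=` ball c r.
Proof.
move=> x; rewrite /open_eball/= => xr.
have r0 : 0 < r by exact: le_lt_trans (enorm_ge0 _) xr.
rewrite ballrVE// => i; rewrite distrC.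
by apply: le_lt_trans xr; have := coord_le_enorm (x - c) i; rewrite !mxE.
Qed.

(** The coordinates only give the bound [d * r] with weak inequality; the extra factor [2] makes it
    strict. *)
Lemma ball_sub_eball c r : 0 < r -> ball c r `<=` open_eball c (2 * n.+1%:R * r).
Proof.
move=> r0 x; rewrite ballrVE// => h; rewrite /open_eball/=.
apply: (@le_lt_trans _ _ (n.+1%:R * r)).
  by apply: enorm_le_coord => i; rewrite !mxE distrC ltW.
by rewrite -mulrA ltr_pMl ?mulr_gt0// ltr1n.
Qed.

Lemma eball_triangle c x r s : enorm (x - c) <= s ->
  open_eball c r `<=` open_eball x (r + s).
Proof.
move=> cx y; rewrite /open_eball/= => yr.
rewrite (_ : y - x = (y - c) + - (x - c)); last by rewrite opprB addrA subrK.
by apply: le_lt_trans (ler_enormD _ _) _; rewrite enormN ltr_leD.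
Qed.

(* The ball of radius [s / 2] is obtained by moving the centre from [x]
   towards [c] by a fraction [s / 2r] of the distance. *)
Lemma closed_eball_fat c r x s : 0 < s <= 2 * r -> closed_eball c r x ->
  exists y, open_eball y (s / 2) `<=` closed_eball c r `&` open_eball x s.
Proof.
move=> /andP[s0 sr] xr.
have r0 : 0 < r by move: s0 sr; lra.
pose t := s / (2 * r).
have t01 : 0 <= t <= 1.
  apply/andP; split; first by apply: divr_ge0; lra.
  by rewrite ler_pdivrMr ?mul1r//; lra.
have tr : t * r = s / 2 by rewrite /t; field; rewrite gt_eqF.
pose y := x + t *: (c - x).
exists y => z zy; split; rewrite /closed_eball /open_eball/=.
- have -> : z - c = (z - y) + (1 - t) *: (x - c).
    by apply/rowP => i; rewrite /y !mxE; ring.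
  apply: le_trans (ler_enormD _ _) _; rewrite enormZ ger0_norm; last lra.
  have : (1 - t) * enorm (x - c) <= (1 - t) * r by rewrite ler_wpM2l//; lra.
  move: zy; rewrite /open_eball/=; lra.
- have -> : z - x = (z - y) + (- t) *: (x - c).
    by apply/rowP => i; rewrite /y !mxE; ring.
  apply: le_lt_trans (ler_enormD _ _) _; rewrite enormZ normrN ger0_norm; last lra.
  have : t * enorm (x - c) <= t * r by rewrite ler_wpM2l//; lra.
  move: zy; rewrite /open_eball/=; lra.
Qed.

End euclidean_norm.

(** * Lebesgue measure of Euclidean balls *)

Section eball_measure.
Context {R : realType} {n : nat}.
Local Notation E := 'rV[R]_n.+1.
Local Notation X := (lebesgue_rV R n).
Local Notation mu := (@lebesgue_measure_rV R n).
Local Open Scope ereal_scope.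
Implicit Types (x y c : E) (r s t : R).

Lemma measurable_eball c r : measurable (open_eball c r : set X).
Proof.
have := @measurable_enorm R n c measurableT `]-oo, r[%classic (measurable_itv _).
by rewrite setTI; congr measurable; apply/seteqP; split => x /=; rewrite in_itv.
Qed.

Lemma measurable_closed_eball c r : measurable (closed_eball c r : set X).
Proof.
have := @measurable_enorm R n c measurableT `]-oo, r]%classic (measurable_itv _).
by rewrite setTI; congr measurable; apply/seteqP; split => x /=; rewrite in_itv.
Qed.

Definition eballc : R := fine (mu (open_eball (0%R : E) 1%R)).

Lemma eball_dilation c r : (0 < r)%R ->
  open_eball c r = dilation c r @` open_eball (0%R : E) 1%R.
Proof.
move=> r0; apply/seteqP; split => [x /= h|_ [x /= h <-]].
  exists (r^-1 *: (x - c))%R; last first.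
    by rewrite /dilation scalerA divff ?gt_eqF// scale1r addrC subrK.
  rewrite /open_eball/= subr0 enormZ gtr0_norm ?invr_gt0//.
  by rewrite ltr_pdivrMl// mulr1.
move: h; rewrite /open_eball/= subr0 /dilation addrAC subrr add0r enormZ gtr0_norm//.
by rewrite gtr_pMr.
Qed.

Lemma eball01_fin : mu (open_eball (0%R : E) 1%R) \is a fin_num.
Proof.
rewrite ge0_fin_numE//; apply: (@le_lt_trans _ _ (mu (ball (0%R : E) 1%R))).
  by apply: le_outer_measure; exact: eball_sub_ball.
by rewrite mu_ball// ltry.
Qed.

Lemma mu_eball c r : (0 < r)%R -> mu (open_eball c r) = (eballc * r ^+ n.+1)%:E.
Proof.
by move=> r0; rewrite eball_dilation// mu_dilation// EFinM muleC /eballc fineK// eball01_fin.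
Qed.

Lemma eballc_gt0 : (0 < eballc)%R.
Proof.
rewrite -lte_fin /eballc fineK ?eball01_fin//.
pose s : R := ((2 * n.+1%:R)^-1)%R.
have s0 : (0 < s)%R by rewrite invr_gt0 mulr_gt0.
apply: (@lt_le_trans _ _ (mu (ball (0%R : E) s))).
  by rewrite mu_ball ?ltW// lte_fin mulr_gt0 ?ballc_gt0 ?exprn_gt0.
apply: le_outer_measure; have := @ball_sub_eball R n 0%R s s0.
by rewrite mulfV// gt_eqF// mulr_gt0.
Qed.

End eball_measure.

(** * Weak-type estimates *)

Section integral_sequences_of_sets.
Context d (T : measurableType d) (R : realType).
Variable mu : {measure set T -> \bar R}.
Variable h : T -> R.
Hypotheses (mh : measurable_fun setT h) (h0 : forall x, 0 <= h x).
Local Open Scope ereal_scope.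

Let mhE D : measurable_fun D (EFin \o h).
Proof. by apply/measurable_EFinP; exact: measurable_funS mh. Qed.

Lemma ge0_integral_indic (D : set T) : measurable D ->
  \int[mu]_x (h x * \1_D x)%:E = \int[mu]_(x in D) (h x)%:E.
Proof.
move=> mD; rewrite [RHS]integral_mkcond; apply: eq_integral => x _.
by rewrite patchE indicE; case: ifPn => xD; rewrite ?mulr1 ?mulr0.
Qed.

Lemma le_integral_bigcup (F : (set T)^nat) : (forall k, measurable (F k)) ->
  \int[mu]_(x in \bigcup_k F k) (h x)%:E <= \sum_(k <oo) \int[mu]_(x in F k) (h x)%:E.
Proof.
move=> mF; have mU : measurable (\bigcup_k F k) by exact: bigcup_measurable.
have mhi D : measurable D -> measurable_fun setT (fun x => (h x * \1_D x)%:E).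
  by move=> mD; apply/measurable_EFinP/measurable_funM => //; exact: measurable_indic.
rewrite -ge0_integral_indic//.
under eq_eseriesr => k _ do rewrite -ge0_integral_indic//.
rewrite -integral_nneseries//; last first.
- by move=> k x _; rewrite lee_fin mulr_ge0.
- by move=> k; exact: mhi.
apply: ge0_le_integral => //.
- by move=> x _; rewrite lee_fin mulr_ge0.
- exact: mhi.
- by apply: emeasurable_nneseries => [k x|k]; [rewrite lee_fin mulr_ge0|exact: mhi].
move=> x _; have [[k _ Fkx]|nUx] := pselect ((\bigcup_k F k) x); last first.
  rewrite indicE memNset// mulr0; apply: nneseries_ge0 => k _ _.
  by rewrite lee_fin mulr_ge0.
rewrite (@nneseriesD1 _ _ k)//; last by move=> m _; rewrite lee_fin mulr_ge0.
rewrite !indicE !mem_set//; last by exists k.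
by apply: leeDl; apply: nneseries_ge0 => m _ _; rewrite lee_fin mulr_ge0.
Qed.

Lemma integral_trivIset_le (F : (set T)^nat) : (forall k, measurable (F k)) ->
  trivIset setT F ->
  \sum_(k <oo) \int[mu]_(x in F k) (h x)%:E <= \int[mu]_x (h x)%:E.
Proof.
move=> mF tF; rewrite -(@ge0_integral_bigcup _ _ _ mu F (EFin \o h))//.
apply: ge0_subset_integral => //.
- exact: bigcup_measurable.
- by move=> x _; rewrite lee_fin.
- by move=> x _; rewrite lee_fin.
Qed.

End integral_sequences_of_sets.

Lemma null_measurable_rV {R : realType} {n : nat} (N : set (lebesgue_rV R n)) :
  lebesgue_measure_rV N = 0%E -> measurable N.
Proof.
move=> N0; apply: le_caratheodory_measurable => A.
rewrite -[leRHS]add0e -[0%E in leRHS]N0.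
by apply: leeD; apply: le_outer_measure => x [].
Qed.

(** * Weak-type estimate and reverse weak-type estimate for the maximal function *)

Section maximal_weak_type.
Context {R : realType} {n : nat}.
Local Notation E := 'rV[R]_n.+1.
Local Notation X := (lebesgue_rV R n).
Local Notation mu := (@lebesgue_measure_rV R n).
Local Notation kappa := (@ballc R n).
Local Notation eta := (@eballc R n).
Local Open Scope ereal_scope.
Implicit Types (c x : E) (r s t : R) (A : set E).

(** [maximal f] unfolds to [average_sup (cabs f)]. *)
Definition average_sup (g : E -> R) x : \bar R :=
  ereal_sup [set (mu (open_eball x r))^-1 *
                 \int[mu]_(y in open_eball x r) (g y)%:E
            | r in [set r : R | (0 < r)%R]].

Definition superlevel (g : E -> R) t : set E := [set x | (t < g x)%R].

Variable g : E -> R.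
Hypotheses (mg : measurable_fun [set: X] (g : X -> R)) (g0 : forall x, (0 <= g x)%R).

Let I A : \bar R := \int[mu]_(x in (A : set X)) (g x)%:E.

Let mgE (D : set X) : measurable_fun D (fun x : X => (g x)%:E).
Proof. by apply/measurable_EFinP; exact: measurable_funS mg. Qed.

Lemma measurable_superlevel t : measurable (superlevel g t : set X).
Proof.
have := mg measurableT (measurable_itv `]t, +oo[).
by rewrite setTI; congr measurable; apply/seteqP; split => x /=; rewrite in_itv/= andbT.
Qed.

Let le_I (A B : set E) : measurable (A : set X) -> measurable (B : set X) ->
  A `<=` B -> I A <= I B.
Proof.
move=> mA mB AB; apply: ge0_subset_integral => //.
by move=> x _; rewrite lee_fin.
Qed.

Lemma lt_average_supP x t : t%:E < average_sup g x <->
  exists2 r, (0 < r)%R & (t * eta * r ^+ n.+1)%:E < I (open_eball x r).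
Proof.
have e r : (0 < r)%R -> ((t%:E < (mu (open_eball x r))^-1 * I (open_eball x r)) =
    ((t * eta * r ^+ n.+1)%:E < I (open_eball x r))).
  move=> r0; have v0 : (0 < eta * r ^+ n.+1)%R.
    by rewrite mulr_gt0 ?eballc_gt0 ?exprn_gt0.
  by rewrite mu_eball// inver gt_eqF// lte_pdivlMl// -EFinM mulrC mulrA.
split=> [/ereal_sup_gt[_ [r /= r0 <-]]|[r r0]].
  by rewrite e// => h; exists r.
rewrite -e// => h; apply: lt_le_trans h _.
by apply: ereal_sup_ubound; exists r.
Qed.

(** Lower semicontinuity of the maximal function. By monotone convergence, a slightly smaller
    concentric ball already carries enough mass, and it lies in the ball of the original radius
    about every nearby point. *)
Lemma open_superlevel_average_sup t : open [set x | t%:E < average_sup g x].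
Proof.
rewrite openE => x /lt_average_supP[r r0 tr].
pose s k : R := (r * (1 - k.+1%:R^-1))%R.
pose F k : set X := open_eball x (s k).
have sr k : (s k < r)%R by rewrite gtr_pMr// gtrBl invr_gt0.
have ndF : nondecreasing_seq F.
  apply/nondecreasing_seqP => k; apply/subsetPset => y; rewrite /F /open_eball/=.
  move=> /lt_le_trans; apply; rewrite ler_pM2l// lerB// lef_pV2 ?posrE//.
  by rewrite ler_nat.
have UF : \bigcup_k F k = open_eball x r.
  apply/seteqP; split => [y [k _]|y].
    by rewrite /F /open_eball/= => /lt_trans; apply.
  rewrite /open_eball/= => yr.
  have : (0 < 1 - enorm (y - x) / r)%R by rewrite subr_gt0 ltr_pdivrMr// mul1r.
  move=> /ltr_add_invr[k]; rewrite add0r => hk; exists k => //.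
  by rewrite /F /open_eball/= /s mulrC -ltr_pdivrMr// ltrBrDr addrC -ltrBrDr.
have mF k : measurable (F k) by exact: measurable_eball.
have := @ge0_nondecreasing_set_cvg_integral _ _ _ F (fun x => (g x)%:E)
  mu ndF mF (fun k => @mgE (F k)) (fun k x _ => g0 x).
rewrite UF => cvgF.
have [k _ /(_ k (leqnn k)) /= hk] := cvgF _ (open_ereal_gt' tr).
near=> y; apply/lt_average_supP; exists r; [exact: r0|apply: lt_le_trans hk _].
apply: le_I; [exact: mF|exact: measurable_eball|].
rewrite (_ : r = s k + (r - s k))%R; last by ring.
apply: eball_triangle; apply: ltW; near: y.
pose e := ((2 * n.+1%:R)^-1 * (r - s k))%R.
have e0 : (0 < e)%R by rewrite mulr_gt0 ?invr_gt0 ?mulr_gt0// subr_gt0.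
apply/nbhs_ballP; exists e => //= y.
move=> /(ball_sub_eball e0); rewrite /open_eball/= /e mulrA mulfV ?mul1r//.
Unshelve. all: by end_near. Qed.

Lemma measurable_average_sup : measurable_fun [set: X] (average_sup g : X -> \bar R).
Proof.
apply: (measurability _ (ErealGenOInfty.measurableE R)) => _ [_ [t ->] <-].
rewrite setTI; apply: (@open_measurable_rV R n).
rewrite (_ : _ @^-1` _ = [set x | t%:E < average_sup g x]).
  exact: open_superlevel_average_sup.
by apply/seteqP; split => x /=; rewrite in_itv/= andbT.
Qed.

Lemma measurable_superlevel_average_sup t :
  measurable ([set x | t%:E < average_sup g x] : set X).
Proof. exact/(@open_measurable_rV R n)/open_superlevel_average_sup. Qed.

Let G := fine (I setT).
Hypothesis g_fin : I setT < +oo.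

Let IT : I setT = G%:E.
Proof.
rewrite /G fineK// ge0_fin_numE//; apply: integral_ge0 => x _.
by rewrite lee_fin.
Qed.

Let I_le_G A : measurable (A : set X) -> I A <= G%:E.
Proof. by move=> mA; rewrite -IT; apply: le_I. Qed.

Let G_ge0 : (0 <= G)%R.
Proof. by rewrite fine_ge0// integral_ge0// => x _; rewrite lee_fin. Qed.

Lemma sum_mu_ball (k : R) (c : nat -> E) (rho : nat -> R) : (0 <= k)%R ->
  (forall i, 0 <= rho i)%R ->
  trivIset setT (fun i => ball (c i) (rho i)) ->
  \sum_(i <oo) mu (ball (c i) (k * rho i)) =
  (k ^+ n.+1)%:E * mu (\bigcup_i ball (c i) (rho i)).
Proof.
move=> k0 rho0 tB; rewrite measure_semi_bigcup//; last 2 first.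
- by move=> i; exact: measurable_ballrV.
- by apply: bigcup_measurable => i _; exact: measurable_ballrV.
rewrite -nneseriesZl//; apply: eq_eseriesr => i _.
rewrite mu_ball ?mulr_ge0// [X in _ * X](mu_ball (c i) (rho0 i)) -EFinM exprMn.
by congr EFin; ring.
Qed.

Let selected_ge0 (A : set E) (r : E -> R) (c : nat -> E) (rho : nat -> R) :
  (forall x, A x -> (0 < r x)%R) ->
  (forall k, rho k = 0%R \/ (A (c k) /\ rho k = r (c k))) ->
  forall k, (0 <= rho k)%R.
Proof. by move=> r0 h k; have [->//|[/r0 /ltW + ->]] := h k. Qed.

Definition truncate t x : R := (g x * \1_(superlevel g t) x)%R.

Lemma truncate_ge0 t x : (0 <= truncate t x)%R.
Proof. by rewrite mulr_ge0. Qed.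

Lemma measurable_truncate t : measurable_fun [set: X] (truncate t : X -> R).
Proof.
apply: measurable_funM; first exact: mg.
by apply: measurable_indic; exact: measurable_superlevel.
Qed.

Lemma integral_le_truncate t A : (0 <= t)%R -> measurable (A : set X) ->
  I A <= \int[mu]_(x in (A : set X)) (truncate t x)%:E + t%:E * mu A.
Proof.
move=> t0 mA; have mt : measurable_fun (A : set X) (fun x : X => (truncate t x)%:E).
  by apply/measurable_EFinP; apply: measurable_funS (measurable_truncate t).
rewrite -[t%:E * _](integral_cst _ mA) -ge0_integralD; last first.
- exact: measurable_cst.
- by move=> x _; rewrite lee_fin.
- exact: mt.
- by move=> x _; rewrite lee_fin truncate_ge0.
- exact: mA.
apply: ge0_le_integral.
- exact: mA.
- by move=> x _; rewrite lee_fin.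
- exact: mgE.
- by apply: emeasurable_funD; [exact: mt|exact: measurable_cst].
move=> x _; rewrite -EFinD lee_fin /truncate indicE.
have [xt|xt] := ltP t (g x); first by rewrite mem_set// mulr1 lerDl.
by rewrite memNset ?mulr0 ?add0r//=; apply/negP; rewrite -leNgt.
Qed.

(** With this threshold the part of [g] below [a * t] contributes at most [t * eta * r ^ d / 2] to a
    sup-norm ball of radius [r], half of the mass [t * eta * r ^ d] that a Euclidean ball of average
    [t] carries. *)
Let a : R := (eta / (2 * kappa))%R.

Lemma weak_type : exists2 C : R, (0 < C)%R & forall t, (0 < t)%R ->
  mu [set x | t%:E < average_sup g x] <=
  (C / t)%:E * \int[mu]_x (truncate (a * t) x)%:E.
Proof.
have eta0 := @eballc_gt0 R n; have kappa0 := @ballc_gt0 R n.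
exists (2 * kappa * 3 ^+ n.+1 / eta)%R; first by rewrite divr_gt0 ?mulr_gt0 ?exprn_gt0.
move=> t t0; set A := [set x | _].
have s0 : (0 <= a * t)%R by rewrite mulr_ge0 ?divr_ge0 ?mulr_ge0 ?ltW.
have h0 x := truncate_ge0 (a * t) x; have mh := @measurable_truncate (a * t).
pose T D := \int[mu]_(x in (D : set X)) (truncate (a * t) x)%:E.
have T0 D : 0 <= T D by apply: integral_ge0 => x _; rewrite lee_fin.
have /choice[r hr] x : exists r, A x -> (0 < r)%R /\
    (t * eta * r ^+ n.+1)%:E < I (open_eball x r).
  have [Ax|nAx] := pselect (A x); last by exists 0%R.
  by have /lt_average_supP[r r0 hr] := Ax; exists r.
have r0 x : A x -> (0 < r x)%R by move=> /hr[].
(* Bounded radii for Vitali's lemma: the total mass [G] bounds [t * eta * r ^ d], and [r <= r ^ d]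
   as soon as [r > 1]. *)
have rM x : A x -> (r x <= 1 + G / (t * eta))%R.
  move=> Ax; have [_ h] := hr _ Ax.
  have Gt : (0 <= G / (t * eta))%R by rewrite divr_ge0 ?mulr_ge0// ltW.
  have [r1|r1] := leP (r x) 1%R; first by move: r1 Gt; lra.
  apply: (@le_trans _ _ (G / (t * eta))%R); last by lra.
  rewrite ler_pdivlMr ?mulr_gt0// mulrC.
  have h' := lt_le_trans h (I_le_G (measurable_eball _ _)); rewrite lte_fin in h'.
  apply: le_trans (ltW h'); rewrite ler_pM2l ?mulr_gt0//.
  by apply: ler_eXnr => //; exact: ltW.
have rT x : A x -> (t * eta / 2 * r x ^+ n.+1)%:E <= T (ball x (r x)).
  move=> Ax; have [rx0 h] := hr _ Ax.
  have := lt_le_trans h (le_I (measurable_eball _ _) (measurable_ballrV _ _) (@eball_sub_ball _ _ _ _)).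
  move=> /lt_le_trans/(_ (integral_le_truncate s0 (measurable_ballrV _ _))).
  rewrite (mu_ball x (ltW rx0)) -EFinM -/(T _) -lteBlDr// -EFinB => /ltW; apply: le_trans.
  by rewrite lee_fin /a le_eqVlt; apply/orP; left; apply/eqP; field; rewrite gt_eqF.
have [c [rho [hc tB AB]]] := vitali_covering r0 rM.
have rho0 := selected_ge0 r0 hc.
apply: le_trans (le_outer_measure _ _ _ AB) _.
apply: le_trans (outer_measure_sigma_subadditive _ _) _.
have C0 : (0 < 2 * kappa * 3 ^+ n.+1 / eta / t)%R.
  by rewrite !divr_gt0 ?mulr_gt0 ?exprn_gt0.
apply: (@le_trans _ _ (\sum_(k <oo) ((2 * kappa * 3 ^+ n.+1 / eta / t)%:E * T (ball (c k) (rho k))))).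
  apply: lee_nneseries => [k _ _|k _]; first exact: outer_measure_ge0.
  have k3 : (0 <= 3 * rho k)%R by rewrite mulr_ge0.
  apply: (@le_trans _ _ (kappa * (3 * rho k) ^+ n.+1)%:E); first by rewrite -(mu_ball (c k) k3).
  have [->|[Ac ->]] := hc k; first by rewrite mulr0 expr0n/= mulr0 mule_ge0// lee_fin ltW.
  rewrite -lee_pdivrMl// -EFinM; apply: le_trans (rT _ Ac).
  rewrite lee_fin exprMn le_eqVlt; apply/orP; left; apply/eqP.
  by field; rewrite ?gt_eqF ?exprn_gt0.
rewrite nneseriesZl; last by move=> k _; exact: T0.
rewrite lee_pmul2l//; apply: integral_trivIset_le => // k.
exact: measurable_ballrV.
Qed.

Lemma integral_truncate t A : measurable (A : set X) ->
  \int[mu]_(x in (A : set X)) (truncate t x)%:E = I (A `&` superlevel g t).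
Proof.
move=> mA; rewrite /I integral_mkcond [RHS]integral_mkcond.
apply: eq_integral => x _; rewrite !patchE /truncate indicE in_setI.
by case: (x \in A) => //; case: (x \in _); rewrite ?mulr1 ?mulr0.
Qed.

Variables (c0 : E) (r0 : R).
Hypothesis r0_gt0 : (0 < r0)%R.
Let B := closed_eball c0 r0.
Hypothesis gB : forall x, ~ B x -> g x = 0%R.

Let superlevel_sub t : (0 < t)%R -> superlevel g t `<=` B.
Proof.
move=> t0 x; rewrite /superlevel/= => tx; apply: contrapT => /gB gx0.
by move: tx; rewrite gx0 ltNge ltW.
Qed.

(** [3 ^ d] pays for Vitali's tripled balls and [2 ^ d] for the open approximation; the [4] leaves a
    factor [1/2] after the approximation error has doubled the measure, so that the density argument
    ends in [t * m <= t * m / 2]. *)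
Let q : R := ((3 ^+ n.+1 * 2 ^+ n.+1 * 4)^-1)%R.

Let q_gt0 : (0 < q)%R.
Proof. by rewrite invr_gt0 !mulr_gt0 ?exprn_gt0. Qed.

Lemma mu_closed_eball_fin c r : mu (closed_eball c r) < +oo.
Proof.
pose s := (Num.max r 0 + 1)%R.
have s0 : (0 < s)%R by rewrite ltr_pwDr// le_max lexx orbT.
apply: (@le_lt_trans _ _ (mu (open_eball c s))); last by rewrite mu_eball ?ltry.
apply: le_outer_measure => x; rewrite /closed_eball /open_eball/= => xr.
by rewrite ltr_pwDr// le_max xr.
Qed.

Let le_integral_covering s (c : nat -> E) (rho : nat -> R) : (0 <= s)%R ->
  (forall k, 0 <= rho k)%R -> trivIset setT (fun k => ball (c k) (rho k)) ->
  (forall k, I (ball (c k) (3 * rho k)) <= (s * kappa * (3 * rho k) ^+ n.+1)%:E) ->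
  I (\bigcup_k ball (c k) (3 * rho k)) <=
  (s * 3 ^+ n.+1)%:E * mu (\bigcup_k ball (c k) (rho k)).
Proof.
move=> s0 rho0 tB hI; have mB k : measurable (ball (c k) (3 * rho k) : set X).
  exact: measurable_ballrV.
apply: le_trans (le_integral_bigcup _ mg g0 mB) _.
have h3 : (0 <= 3 :> R)%R by [].
rewrite EFinM -muleA -(sum_mu_ball h3 rho0 tB).
rewrite -nneseriesZl; last by move=> k _; exact: outer_measure_ge0.
apply: lee_nneseries => [k _ _|k _].
  by apply: integral_ge0 => x _; rewrite lee_fin.
have k3 : (0 <= 3 * rho k)%R by rewrite mulr_ge0.
by rewrite (mu_ball (c k) k3) -EFinM mulrA; exact: hI.
Qed.

(* A point of [superlevel g t] around which all the averages of [g] are small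
   is exceptional.  The proof only uses that [mu] is an outer measure which is
   outer regular up to a constant factor, not the differentiation theorem. *)
Lemma mu_small_averages_eq0 t : (0 < t)%R ->
  mu [set x | superlevel g t x /\
    forall r, (0 < r)%R -> I (ball x r) <= (q * t * kappa * r ^+ n.+1)%:E] = 0.
Proof.
move=> t0; set N := [set x | _].
have Noo : mu N < +oo.
  apply: le_lt_trans (mu_closed_eball_fin c0 r0); apply: le_outer_measure => x [tx _].
  exact: superlevel_sub tx.
have Nge0 : 0 <= mu N by exact: outer_measure_ge0.
have Nfin : mu N \is a fin_num by rewrite ge0_fin_numE.
apply/eqP; rewrite eq_le Nge0 andbT leNgt; apply/negP => N0.
pose m := fine (mu N).
have Nm : mu N = m%:E by rewrite /m fineK.
have m0 : (0 < m)%R by rewrite -lte_fin -Nm.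
have [U [oU NU Um]] := mu_open_approx m0 Noo.
have /choice[r hr] x : exists r, N x -> [/\ (0 < r)%R, (r <= 1)%R & ball x r `<=` U].
  have [Nx|nNx] := pselect (N x); last by exists 0%R.
  have /nbhs_ballP[e /= e0 eU] : nbhs x U by apply: open_nbhs_nbhs; split; [|exact: NU].
  (* The ball stays in [U], and the cap at [1] bounds the radii for Vitali's lemma. *)
  exists (Num.min e 1%R) => _; split; first by rewrite lt_min e0 ltr01.
    by rewrite ge_min lexx orbT.
  by apply: subset_trans eU; apply: le_ball; rewrite ge_min lexx.
have r_gt0 x : N x -> (0 < r x)%R by move=> /hr[].
have r_le1 x : N x -> (r x <= 1)%R by move=> /hr[].
have [c [rho [hc tB NB]]] := vitali_covering r_gt0 r_le1.
have rho0 := selected_ge0 r_gt0 hc.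
pose V := \bigcup_k ball (c k) (3 * rho k).
have mV : measurable (V : set X).
  by apply: bigcup_measurable => k _; exact: measurable_ballrV.
have mS := measurable_superlevel t.
have mVS : measurable ((V `&` superlevel g t) : set X) by exact: measurableI.
(* [N] is not known to be measurable here, so [g] is integrated over the measurable set [V] cut by
   the superlevel set, which contains [N]. *)
have tN : t%:E * mu N <= I V.
  apply: (@le_trans _ _ (I (V `&` superlevel g t))); last first.
    by apply: le_I => // x [].
  apply: (@le_trans _ _ (t%:E * mu (V `&` superlevel g t))).
    rewrite lee_pmul2l//; apply: le_outer_measure => x Nx; split; first exact: NB.
    exact: Nx.1.
  rewrite -[leLHS](integral_cst mu mVS); apply: ge0_le_integral.
  - exact: mVS.
  - by move=> x _; rewrite lee_fin ltW.
  - exact: measurable_cst.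
  - exact: mgE.
  - by move=> x [_ tx]; rewrite lee_fin ltW.
have qt0 : (0 < q * t)%R by rewrite mulr_gt0.
have IV : I V <= (q * t * 3 ^+ n.+1)%:E * mu (\bigcup_k ball (c k) (rho k)).
  apply: le_integral_covering; [exact: ltW|by []|by []|move=> k].
  have [->|[Nc rE]] := hc k.
    by rewrite mulr0 ballrV_le0// /I integral_set0 expr0n/= mulr0.
  by apply: Nc.2; rewrite rE mulr_gt0// r_gt0.
(* The smallness of the averages is used on the tripled balls, whereas only the original balls,
   which lie in [U], are measured. *)
have BU : mu (\bigcup_k ball (c k) (rho k)) <= (2 ^+ n.+1)%:E * (m%:E + m%:E).
  rewrite -{1}Nm; apply: le_trans Um; apply: le_outer_measure => x [k _].
  have [->|[Nc ->]] := hc k; first by rewrite ballrV_le0.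
  by have [_ _] := hr _ Nc; apply.
have h : t%:E * mu N <=
    (q * t * 3 ^+ n.+1)%:E * ((2 ^+ n.+1)%:E * (m%:E + m%:E)).
  apply: le_trans (le_trans tN IV) _.
  by rewrite lee_pmul2l ?lte_fin ?mulr_gt0 ?exprn_gt0.
move: h; rewrite Nm -EFinD -!EFinM lee_fin leNgt => /negP; apply.
have -> : (q * t * 3 ^+ n.+1 * (2 ^+ n.+1 * (m + m)) = t * m / 2)%R.
  by rewrite /q; field; rewrite !expf_neq0.
by have := mulr_gt0 t0 m0; lra.
Qed.

(** A stopping-radius argument: at almost every point of [superlevel g t] some ball has average
    above [q * t], and the radius is taken more than half of the largest possible. The tripled ball
    then has a small average, which bounds the mass of [g] from above, while the ball itself forces
    the maximal function to be large at all its points. *)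
Lemma reverse_weak_type : exists C l t0 : R, [/\ (0 < C)%R, (0 < l <= 1)%R &
  forall t, (0 < t)%R -> (t0 <= t)%R -> \int[mu]_x (truncate t x)%:E <=
  (C * t)%:E * mu (B `&` [set x | (l * t)%:E < average_sup g x])].
Proof.
have eta0 := @eballc_gt0 R n; have kappa0 := @ballc_gt0 R n.
(* A sup-norm ball of radius [rho] lies in the one of radius [2 * rho] about any of its points,
   hence in the Euclidean ball of radius [2 * d * (2 * rho) = h * rho]. The first entry of [l] is
   the resulting loss in the average; the cap at [1] is what the dyadic sum estimate asks for
   later. *)
pose h : R := (4 * n.+1%:R)%R.
have h0 : (0 < h)%R by rewrite mulr_gt0.
pose l : R := Num.min (q * kappa / (eta * h ^+ n.+1))%R 1%R.
have l0 : (0 < l)%R.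
  by rewrite lt_min ltr01 andbT divr_gt0 ?mulr_gt0 ?exprn_gt0.
(* The first constant is [q * 3 ^ d] times the [K] below. From the last one on, a ball of radius
   above [2 * r0] would need mass greater than [G] to have average above [q * t]. *)
exists (q * 3 ^+ n.+1 * 2 ^+ n.+1 * kappa / eta)%R, l,
  (G / (q * kappa * (2 * r0) ^+ n.+1))%R; split.
- by rewrite divr_gt0 ?mulr_gt0 ?exprn_gt0.
- by rewrite l0 ge_min lexx orbT.
move=> t t0 tG; have qt0 : (0 < q * t)%R by rewrite mulr_gt0.
set N := [set x | superlevel g t x /\
    forall r, (0 < r)%R -> I (ball x r) <= (q * t * kappa * r ^+ n.+1)%:E].
have N0 : mu N = 0 := mu_small_averages_eq0 t0.
pose A := superlevel g t `\` N.
pose S x := [set r | (0 < r)%R /\ (q * t * kappa * r ^+ n.+1)%:E < I (ball x r)].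
have S_le x r : S x r -> (r <= 2 * r0)%R.
  move=> [r_gt0 Sr]; rewrite leNgt; apply/negP => r0r.
  have := lt_le_trans Sr (I_le_G (measurable_ballrV _ _)); rewrite lte_fin.
  apply/negP; rewrite -leNgt; move: tG; rewrite ler_pdivrMr; last first.
    by rewrite !mulr_gt0 ?exprn_gt0 ?mulr_gt0.
  move=> /le_trans; apply; rewrite (_ : (t * _ = q * t * kappa * (2 * r0) ^+ n.+1)%R); last by ring.
  rewrite ler_pM2l ?mulr_gt0// lerXn2r ?nnegrE ?mulr_ge0 ?ltW//.
have /choice[r hr] x : exists r, A x -> S x r /\ ~ S x (3 * r)%R.
  have [[tx nNx]|nAx] := pselect (A x); last by exists 0%R.
  have [s Ss] : exists s, S x s.
    apply: contrapT => nS; apply: nNx; split=> // s s0; rewrite leNgt; apply/negP => hs.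
    by apply: nS; exists s.
  have supS : has_sup (S x) by split; [exists s|exists (2 * r0)%R => y /S_le].
  have sup0 : (0 < sup (S x))%R.
    by apply: lt_le_trans (ub_le_sup supS.2 Ss); case: Ss.
  have [y Sy ysup] := sup_adherent (divr_gt0 sup0 (ltr0Sn R 1)) supS.
  (* As [y] exceeds half the supremum of [S x], the radius [3 * y] is beyond it. *)
  exists y => _; split=> // /(ub_le_sup supS.2); move: ysup sup0; lra.
have r_gt0 x : A x -> (0 < r x)%R by move=> /hr[[]].
have r_le x : A x -> (r x <= 2 * r0)%R by move=> /hr[/S_le].
have [c [rho [hc tB AB]]] := vitali_covering r_gt0 r_le.
have rho0 := selected_ge0 r_gt0 hc.
have mS := measurable_superlevel t.
have mN : measurable (N : set X) by exact: null_measurable_rV.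
have mA : measurable (A : set X) by exact: measurableD.
have mB : measurable (B : set X) by exact: measurable_closed_eball.
have mb k : measurable (ball (c k) (rho k) : set X) by exact: measurable_ballrV.
rewrite integral_truncate// setTI.
rewrite /I (ge0_negligible_integral mN mS (@mgE _) (fun x _ => g0 x) N0).
have IV : I (\bigcup_k ball (c k) (3 * rho k)) <=
    (q * t * 3 ^+ n.+1)%:E * mu (\bigcup_k ball (c k) (rho k)).
  apply: le_integral_covering; [exact: ltW|by []|by []|move=> k].
  have [->|[Ac rE]] := hc k.
    by rewrite mulr0 ballrV_le0// /I integral_set0 expr0n/= mulr0.
  rewrite rE; have [_ nS] := hr _ Ac; rewrite leNgt; apply/negP => nI; apply: nS.
  by split=> //; rewrite mulr_gt0// r_gt0.
have AV : I A <= I (\bigcup_k ball (c k) (3 * rho k)).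
  apply: le_I => //; apply: bigcup_measurable => k _; exact: measurable_ballrV.
apply: le_trans (le_trans AV IV) _.
pose D := B `&` \bigcup_k ball (c k) (rho k).
(* Ratio of the measure of a sup-norm ball of radius [rho] to that of the Euclidean ball of radius
   [rho / 2] which [closed_eball_fat] places inside [B] and the former. *)
pose K := (2 ^+ n.+1 * kappa / eta)%R.
have K0 : (0 < K)%R by rewrite divr_gt0 ?mulr_gt0 ?exprn_gt0.
have ballD k : mu (ball (c k) (rho k)) <= K%:E * mu (B `&` ball (c k) (rho k)).
  have [->|[Ac rE]] := hc k.
    by rewrite mu_ball// expr0n/= mulr0 mule_ge0// ?outer_measure_ge0// lee_fin ltW.
  have rk0 : (0 < rho k)%R by rewrite rE r_gt0.
  have rkr : (0 < rho k <= 2 * r0)%R by rewrite rk0 rE r_le.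
  have [y yB] := closed_eball_fat rkr (superlevel_sub t0 Ac.1).
  have rk2 : (0 < rho k / 2)%R by rewrite divr_gt0.
  apply: (@le_trans _ _ (K%:E * mu (open_eball y (rho k / 2)))); last first.
    rewrite lee_pmul2l//; apply: le_outer_measure => x /yB[Bx xk]; split=> //.
    exact: eball_sub_ball.
  rewrite (mu_ball (c k) (rho0 k)) (mu_eball y rk2) -EFinM lee_fin /K.
  rewrite le_eqVlt; apply/orP; left; apply/eqP; rewrite expr_div_n.
  by field; rewrite expf_neq0//= gt_eqF.
have UD : mu (\bigcup_k ball (c k) (rho k)) <= K%:E * mu D.
  have mD k : measurable ((B `&` ball (c k) (rho k)) : set X) by exact: measurableI.
  have tD : trivIset setT (fun k => B `&` ball (c k) (rho k)).
    by move=> i j _ _ [x [[_ xi] [_ xj]]]; apply: tB => //; exists x.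
  apply: le_trans (outer_measure_sigma_subadditive _ _) _.
  rewrite /D setI_bigcupr [X in _ <= _ * X]measure_semi_bigcup//; last first.
    exact: bigcup_measurable.
  rewrite -nneseriesZl; last by move=> k _; exact: outer_measure_ge0.
  apply: lee_nneseries => [k _ _|k _]; first exact: outer_measure_ge0.
  exact: ballD.
have Dl : D `<=` B `&` [set x | (l * t)%:E < average_sup g x].
  move=> x [Bx [k _ kx]]; split=> //.
  have [rk|[Ac rE]] := hc k; first by move: kx; rewrite rk ballrV_le0.
  have rk0 : (0 < rho k)%R by rewrite rE r_gt0.
  apply/lt_average_supP; exists (h * rho k)%R; first by rewrite mulr_gt0.
  have [[_ +] _] := hr _ Ac; rewrite -rE => hI.
  apply: (@le_lt_trans _ _ (q * t * kappa * rho k ^+ n.+1)%:E).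
    rewrite lee_fin exprMn !mulrA ler_pM2r ?exprn_gt0//.
    apply: (@le_trans _ _ (q * kappa / (eta * h ^+ n.+1) * t * eta * h ^+ n.+1)%R).
      by rewrite !ler_pM2r ?exprn_gt0// ge_min lexx.
    rewrite le_eqVlt; apply/orP; left; apply/eqP.
    by field; rewrite expf_neq0 ?gt_eqF//= gt_eqF.
  apply: lt_le_trans hI _; apply: le_I; [exact: mb|exact: measurable_eball|].
  have rk2 : (0 < 2 * rho k)%R by rewrite mulr_gt0.
  rewrite (_ : h * rho k = 2 * n.+1%:R * (2 * rho k))%R; last by rewrite /h; ring.
  apply: subset_trans (ball_sub_eball rk2) => y ky.
  rewrite (_ : 2 * rho k = rho k + rho k)%R; last by ring.
  exact: ball_triangle (ball_sym kx) ky.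
apply: (@le_trans _ _ ((q * t * 3 ^+ n.+1)%:E * (K%:E * mu D))).
  by rewrite lee_pmul2l ?lte_fin ?mulr_gt0 ?exprn_gt0.
rewrite muleA -EFinM (_ : q * t * 3 ^+ n.+1 * K =
  q * 3 ^+ n.+1 * 2 ^+ n.+1 * kappa / eta * t)%R; last by rewrite /K; ring.
rewrite lee_pmul2l ?lte_fin ?mulr_gt0 ?invr_gt0 ?exprn_gt0//.
exact: le_outer_measure.
Qed.

End maximal_weak_type.

(** * Dyadic sums *)

Section dyadic_sums.
Context {R : realType}.
Implicit Types (x y t s l : R) (k m N : nat).

(** A partial sum of the cut series is at most the full initial sum of [u] up to its last index in
    [P]. *)
Lemma nneseries_cut (u : nat -> R) (P : pred nat) t : (forall k, 0 <= u k) -> 0 <= t ->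
  (forall N, P N -> \sum_(k < N.+1) u k <= t) ->
  (\sum_(k <oo) (u k * (P k)%:R)%:E <= t%:E)%E.
Proof.
move=> u0 t0 ut; apply: lime_le.
  by apply: is_cvg_nneseries => k _ _; rewrite lee_fin mulr_ge0.
apply: nearW => N; rewrite big_mkord sumEFin lee_fin.
elim: N => [|N ih]; first by rewrite big_ord0.
rewrite big_ord_recr/=; have [PN|PN] := boolP (P N); last by rewrite mulr0 addr0.
apply: le_trans (ut N PN); rewrite big_ord_recr/= mulr1 lerD2r.
by apply: ler_sum => k _; rewrite ler_piMr// lern1 leq_b1.
Qed.

Lemma nneseries_cut_ge (u : nat -> R) (P : pred nat) N : (forall k, 0 <= u k) ->
  (forall k, (k <= N)%N -> P k) ->
  ((\sum_(k < N.+1) u k)%:E <= \sum_(k <oo) (u k * (P k)%:R)%:E)%E.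
Proof.
move=> u0 PN; have h0 k : (0 <= (u k * (P k)%:R)%:E)%E by rewrite lee_fin mulr_ge0.
apply: le_trans (nneseries_lim_ge N.+1 (fun k _ _ => h0 k)).
rewrite big_mkord -sumEFin; apply: lee_sum => k _.
by rewrite PN ?mulr1// -ltnS.
Qed.

Lemma ex_dyadic t : 2 < t -> exists k, 2 ^+ k.+1 < t <= 2 ^+ k.+2.
Proof.
move=> t2; have ext : exists m, t <= 2 ^+ m.
  exists (Num.truncn t).+1; apply: le_trans (ltW (truncnS_gt t)) _.
  by rewrite -natrX ler_nat ltnW// ltn_expl.
have [[|[|k]]] := ex_minnP ext.
- by rewrite expr0 => /(lt_le_trans t2); lra.
- by rewrite expr1 leNgt t2.
- move=> tk kmin; exists k; rewrite tk andbT ltNge; apply/negP => /kmin.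
  by rewrite ltnn.
Qed.

Lemma ln2_le1 : ln (2 : R) <= 1.
Proof. by have := @le_ln1Dx R 1; apply; lra. Qed.

Lemma ln2_ge : 2^-1 <= ln (2 : R).
Proof.
have := @le_ln1Dx R (- 2^-1); rewrite (_ : 1 + - 2^-1 = 2^-1); last lra.
by rewrite lnV ?posrE// lerN2; apply; lra.
Qed.

Lemma expR1_le4 : expR 1 <= 4 :> R.
Proof.
rewrite -[leRHS]lnK ?posrE// ler_expR (_ : 4 = 2 ^+ 2); last by ring.
by rewrite lnXn// mulr2n; have := ln2_ge; lra.
Qed.

Lemma ln_exp2_ge k : k%:R / 2 <= ln (2 ^+ k : R).
Proof. by rewrite lnXn// -[leRHS]mulr_natl ler_wpM2l// ln2_ge. Qed.

Lemma ln_exp2_le k : ln (2 ^+ k : R) <= k%:R.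
Proof. by rewrite lnXn// -[leRHS]mulr1 -[leLHS]mulr_natl ler_wpM2l// ln2_le1. Qed.

Lemma ln_expR1D_ge1 t : 0 <= t -> 1 <= ln (expR 1 + t).
Proof.
by move=> t0; rewrite -[leLHS]expRK ler_ln ?posrE ?expR_gt0 ?lerDl// ltr_wpDr// expR_gt0.
Qed.

Lemma harmonic_ge_ln N : ln N.+1%:R <= \sum_(k < N) k.+1%:R^-1 :> R.
Proof.
elim: N => [|N ih]; first by rewrite big_ord0 ln1.
rewrite big_ord_recr/=; apply: le_trans (lerD ih (lexx _)).
rewrite (_ : N.+2%:R = N.+1%:R * (1 + N.+1%:R^-1)); last first.
  by rewrite mulrDr mulr1 mulfV// -natr1.
rewrite lnM ?posrE ?addr_gt0// lerD2l le_ln1Dx//.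
by apply: lt_trans (_ : 0 < _); rewrite ?ltrN10 ?invr_gt0.
Qed.

(** The increment satisfies [1 / (N + 1) <= 2 / (N + 2)], and [ln (1 - s) <= - s] with
    [s = 1 / (N + 2)] bounds [s] by the increment of [ln]. *)
Lemma harmonic_le_ln N : \sum_(k < N) k.+1%:R^-1 <= 2 * ln N.+1%:R :> R.
Proof.
elim: N => [|N ih]; first by rewrite big_ord0 ln1 mulr0.
rewrite big_ord_recr/=; apply: le_trans (lerD ih (lexx _)) _.
rewrite -lerBrDl -mulrBr -ln_div ?posrE//.
have N2 : N.+2%:R = N.+1%:R + 1 :> R by rewrite -natr1.
have N1 : 1 <= N.+1%:R :> R by rewrite ler1n.
rewrite -[X in 2 * ln X]invrK lnV ?posrE ?invr_gt0 ?divr_gt0// invf_div.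
have e : 1 + - N.+2%:R^-1 = N.+1%:R / N.+2%:R :> R.
  by apply: (@mulIf _ N.+2%:R) => //; rewrite mulrDl mulNr mulVf// divfK// N2; ring.
have h2 : N.+2%:R^-1 * 2 >= N.+1%:R^-1 :> R.
  by rewrite ler_pdivlMl// ler_pdivrMr// N2; lra.
have h3 : N.+2%:R^-1 < 1 :> R by rewrite invf_lt1// ltr1n.
have h4 : -1 < - N.+2%:R^-1 :> R by rewrite ltrN2.
apply: le_trans h2 _; rewrite mulrC ler_wpM2l// lerNr -e.
exact: le_ln1Dx.
Qed.

Lemma logp_ge0 t : 0 <= logp t.
Proof. by rewrite le_max lexx orbT. Qed.

Lemma logp_nat_le t s : 1 <= s -> t <= s -> 0 <= t -> logp t <= ln s.
Proof.
move=> s1 ts t0; rewrite /logp ger0_norm// ge_max ln_ge0// andbT.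
have [->|tn0] := eqVneq t 0; first by rewrite ln0// ln_ge0.
have tp : 0 < t by rewrite lt_neqAle eq_sym tn0.
by rewrite ler_ln ?posrE// (lt_le_trans tp).
Qed.

Lemma ln_le_logp t : 0 < t -> ln t <= logp t.
Proof. by move=> t0; rewrite /logp gtr0_norm// le_max lexx. Qed.

(* [log log] is the discrete primitive of [1 / k] along the scale [2 ^ k]. *)
Lemma sum_harmonic_le_loglog l : 0 < l -> exists2 C, 0 < C & forall t, 0 <= t ->
  (\sum_(k <oo) (k.+1%:R^-1 * (l * 2 ^+ k.+1 < t)%R%:R)%:E <=
   (C + 2 * logp (logp t))%:E)%E.
Proof.
move=> l0; pose b := 2 * logp l^-1.
have b0 : 0 <= b by rewrite mulr_ge0// logp_ge0.
exists (2 * ln (3 + b)); first by rewrite mulr_gt0// ln_gt0; lra.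
move=> t t0; rewrite -mulrDr; apply: (nneseries_cut (P := fun k => l * 2 ^+ k.+1 < t)).
- by move=> k; rewrite invr_ge0.
- by rewrite mulr_ge0// addr_ge0 ?logp_ge0// ln_ge0; lra.
(* [l * 2 ^ (N + 1) < t] and [ln 2 >= 1/2] give [N + 1 <= 2 * logp t + b], so the logarithm of
   [N + 2] is a double logarithm of [t] up to a constant. *)
move=> N Nt; apply: le_trans (harmonic_le_ln N.+1) _; rewrite ler_wpM2l//.
have tp : 0 < t by apply: lt_trans Nt; rewrite mulr_gt0 ?exprn_gt0.
pose L := logp t; have L0 : 0 <= L by exact: logp_ge0.
have NL : N.+1%:R <= 2 * L + b.
  have : 2 ^+ N.+1 <= t / l by rewrite ler_pdivlMr// mulrC ltW.
  rewrite -ler_ln ?posrE ?exprn_gt0 ?divr_gt0// lnM ?posrE ?invr_gt0// => h.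
  have := ln_exp2_ge N.+1; have := ln_le_logp tp.
  have li : 0 < l^-1 by rewrite invr_gt0.
  by have := ln_le_logp li; rewrite -/L /b; lra.
(* The maximum with [1] absorbs the additive constants into a factor and makes [ln M] at most
   [logp L]. *)
pose M := Num.max 1 L.
have M1 : 1 <= M by rewrite le_max lexx.
have ML : L <= M by rewrite le_max lexx orbT.
apply: (@le_trans _ _ (ln ((3 + b) * M))).
  rewrite ler_ln ?posrE//; last by rewrite mulr_gt0//; lra.
  rewrite -natr1; apply: (@le_trans _ _ (2 * M + b * M + M)).
    apply: lerD => //; apply: le_trans NL _; apply: lerD; first lra.
    by rewrite ler_peMr.
  lra.
rewrite lnM ?posrE; [|lra|lra].
rewrite lerD2l /M /logp ger0_norm//.
have [_|_] := leP L 1; first by rewrite ln1 le_max lexx orbT.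
by rewrite le_max lexx.
Qed.

(** The first [m] terms are at most [1] each. Dropping them leaves only levels [2 ^ (k + 1)] large
    enough for the reverse weak-type estimate. *)
Lemma loglog_le_sum_harmonic m t : 0 <= t ->
  ((logp (logp t))%:E <= m%:R%:E + \sum_(k <oo)
    (k.+1%:R^-1 * ((m <= k)%N && (2 ^+ k.+1 < t)%R)%:R)%:E)%E.
Proof.
move=> t0; have w0 k : 0 <= k.+1%:R^-1 :> R by rewrite invr_ge0.
have S0 : (0 <= \sum_(k <oo)
    (k.+1%:R^-1 * ((m <= k)%N && (2 ^+ k.+1 < t)%R)%:R : R)%:E)%E.
  by apply: nneseries_ge0 => k _ _; rewrite lee_fin mulr_ge0.
have [t2|/ex_dyadic[K /andP[Kt tK]]] := leP t 2.
  apply: (@le_trans _ _ 0%E); last by rewrite adde_ge0// lee_fin.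
  rewrite lee_fin -ln1; apply: logp_nat_le => //; last exact: logp_ge0.
  apply: le_trans (logp_nat_le _ t2 t0) ln2_le1; lra.
have LK : logp (logp t) <= ln K.+2%:R.
  apply: logp_nat_le; [by rewrite ler1n| |exact: logp_ge0].
  apply: le_trans (logp_nat_le _ tK t0) (ln_exp2_le _).
  by rewrite exprn_ege1// ler1n.
apply: (@le_trans _ _ (\sum_(k < K.+1) k.+1%:R^-1 : R)%:E).
  by rewrite lee_fin; apply: le_trans LK (harmonic_ge_ln _).
apply: (@le_trans _ _ (\sum_(k <oo) (k.+1%:R^-1 * (2 ^+ k.+1 < t)%R%:R)%:E)%E).
  apply: (nneseries_cut_ge (u := fun k => k.+1%:R^-1) (P := fun k => 2 ^+ k.+1 < t)) => //.
  by move=> k kK; apply: le_lt_trans Kt; rewrite ler_eXn2l// ltr1n.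
apply: (@le_trans _ _ (\sum_(k <oo) ((k.+1%:R^-1 * (k < m)%N%:R)%:E +
    (k.+1%:R^-1 * ((m <= k)%N && (2 ^+ k.+1 < t)%R)%:R)%:E))%E).
  apply: lee_nneseries => [k _ _|k _]; first by rewrite lee_fin mulr_ge0.
  rewrite -EFinD lee_fin -mulrDr ler_wpM2l//.
  by case: leqP => _ /=; rewrite ?add0r ?addr0// lern1 leq_b1.
rewrite nneseriesD; [|by move=> k _ _; rewrite lee_fin mulr_ge0..].
rewrite leeD2r//; apply: (nneseries_cut (P := fun k => (k < m)%N)) => // N Nm.
apply: (@le_trans _ _ (\sum_(k < N.+1) 1)); last by rewrite sumr_const card_ord ler_nat.
by apply: ler_sum => k _; rewrite invf_le1// ler1n.
Qed.

(** From denominator [2] on, consecutive terms grow by a factor of at least [4/3], so the last term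
    dominates as in a geometric sum; the first two sums are checked directly. *)
Lemma sum_exp2_div_le N :
  \sum_(k < N.+1) 2 ^+ k.+1 / k.+1%:R <= 4 * (2 ^+ N.+1 / N.+1%:R) :> R.
Proof.
elim: N => [|[|N] ih]; first by rewrite big_ord_recr big_ord0/= !expr1 add0r invr1; lra.
  by rewrite !big_ord_recr big_ord0/= !expr1 expr2 add0r invr1; lra.
rewrite big_ord_recr/=; apply: le_trans (lerD ih (lexx _)) _.
set a := 2 ^+ N.+2; have a0 : 0 < a :> R by rewrite exprn_gt0.
rewrite (exprS _ N.+2) -/a; set u := N.+3%:R^-1.
have au : a / N.+2%:R <= a * (3 / 2 * u).
  rewrite ler_pM2l// /u mulrC ler_pdivlMl// ler_pdivrMr//.
  have e3 : N.+3%:R = N%:R + 3 :> R by rewrite -addn3 natrD.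
  have e2 : N.+2%:R = N%:R + 2 :> R by rewrite -addn2 natrD.
  by have N0 : 0 <= N%:R :> R by []; rewrite e3 e2; lra.
by move: au; move: (a / _) u => v u; lra.
Qed.

(** With [2 ^ (K + 1) < t / l <= 2 ^ (K + 2)], the sum is controlled by its term of index [K], and
    [e + t <= 2 ^ (K + 4)] gives [ln (e + t) <= 4 (K + 1)]. The two factors [4] make up the [16]. *)
Lemma sum_exp2_div_le_log l t : 0 < l <= 1 -> 0 <= t ->
  (\sum_(k <oo) (2 ^+ k.+1 / k.+1%:R * (l * 2 ^+ k.+1 < t)%R%:R)%:E <=
   (16 / l * (t / ln (expR 1 + t)))%:E)%E.
Proof.
move=> /andP[l0 l1] t0; have ln1t := ln_expR1D_ge1 t0.
have lnp : 0 < ln (expR 1 + t) by lra.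
have ul0 : 0 <= t / ln (expR 1 + t) by rewrite divr_ge0// ltW.
apply: (nneseries_cut (P := fun k => l * 2 ^+ k.+1 < t)).
- by move=> k; rewrite divr_ge0// exprn_ge0.
- by rewrite mulr_ge0// divr_ge0// ltW.
move=> N Nt; have Nt' : 2 ^+ N.+1 < t / l by rewrite ltr_pdivlMr// mulrC.
have H2 : 2 < t / l.
  by apply: le_lt_trans Nt'; rewrite exprS ler_peMr// exprn_ege1// ler1n.
have [K /andP[KH HK]] := ex_dyadic H2.
have NK : (N <= K)%N.
  by have := lt_le_trans Nt' HK; rewrite ltr_eXn2l ?ltr1n// !ltnS.
apply: (@le_trans _ _ (\sum_(k < K.+1) 2 ^+ k.+1 / k.+1%:R)).
  by rewrite -(subnKC NK) -addSn big_split_ord/= lerDl sumr_ge0.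
apply: le_trans (sum_exp2_div_le K) _.
have lnt : ln (expR 1 + t) <= 4 * K.+1%:R.
  apply: (@le_trans _ _ (ln (2 ^+ K.+4))).
    rewrite ler_ln ?posrE ?exprn_gt0//; last by rewrite ltr_wpDr ?expR_gt0.
    have := expR1_le4; have tH : t <= t / l by rewrite ler_peMr// invf_ge1.
    have p1 : 1 <= 2 ^+ K :> R by rewrite exprn_ege1// ler1n.
    by move: HK; rewrite !exprS; lra.
  apply: le_trans (ln_exp2_le _) _.
  by rewrite -natrM ler_nat mulnS -addn4 addnC leq_add2l leq_pmull.
rewrite (_ : 16 / l * (t / ln (expR 1 + t)) = 4 * (4 * (t / l) / ln (expR 1 + t))); last first.
  by field; rewrite !gt_eqF.
rewrite ler_wpM2l// ler_pdivlMr// mulrAC ler_pdivrMr//.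
have p0 : 0 < 2 ^+ K.+1 :> R by rewrite exprn_gt0.
have := ler_pM (ltW p0) (ltW lnp) (ltW KH) lnt; lra.
Qed.

(** The last term with [2 ^ (k + 1) < t] already suffices, by [t <= 2 ^ (k + 2)] and
    [ln (e + t) >= (k + 1) / 2]; the constant [2] handles [t <= 2]. *)
Lemma Psi_le_sum n (x : 'rV[R]_n.+1) t : 0 <= t ->
  ((Psi x t)%:E <= 2%:E + \sum_(k <oo) (2 ^+ k.+3 / k.+1%:R * (2 ^+ k.+1 < t)%R%:R)%:E)%E.
Proof.
move=> t0; have ln1t := ln_expR1D_ge1 t0; have ln1x := ln_expR1D_ge1 (enorm_ge0 x).
have u0 k : 0 <= 2 ^+ k.+3 / k.+1%:R :> R by rewrite divr_ge0// exprn_ge0.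
have S0 : (0 <= \sum_(k <oo) (2 ^+ k.+3 / k.+1%:R * (2 ^+ k.+1 < t)%R%:R : R)%:E)%E.
  by apply: nneseries_ge0 => k _ _; rewrite lee_fin mulr_ge0.
have [t2|/ex_dyadic[K /andP[Kt tK]]] := leP t 2.
  apply: (@le_trans _ _ 2%:E); last exact: leeDl.
  rewrite lee_fin /Psi ler_pdivrMr; last lra.
  nra.
apply: (@le_trans _ _ (2 ^+ K.+3 / K.+1%:R)%:E).
  rewrite lee_fin /Psi ler_pdivrMr; last lra.
  have h : K.+1%:R / 2 <= ln (expR 1 + t).
    apply: le_trans (ln_exp2_ge _) _.
    rewrite ler_ln ?posrE ?exprn_gt0//; first by have := expR_gt0 (1 : R); lra.
    by rewrite ltr_wpDr ?expR_gt0.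
  rewrite mulrAC ler_pdivlMr//.
  apply: (@le_trans _ _ (2 ^+ K.+2 * K.+1%:R)); first by rewrite ler_wpM2r.
  rewrite (exprS _ K.+2).
  have p0 : 0 < 2 ^+ K.+2 :> R by rewrite exprn_gt0.
  nra.
rewrite -[leLHS]add0e; apply: leeD => //.
rewrite (@nneseriesD1 _ _ K)//.
rewrite Kt mulr1; apply: leeDl; apply: nneseries_ge0 => k _ _.
by rewrite lee_fin mulr_ge0.
Qed.

(** As [ln (e + t) >= 1], the denominator of [Psi] is at most [(1 + M) * ln (e + t)]. *)
Lemma le_Psi n (x : 'rV[R]_n.+1) t M : 0 <= t -> ln (expR 1 + enorm x) <= M ->
  t / ln (expR 1 + t) <= (1 + M) * Psi x t.
Proof.
move=> t0 xM; have ln1t := ln_expR1D_ge1 t0; have ln1x := ln_expR1D_ge1 (enorm_ge0 x).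
rewrite /Psi mulrA ler_pdivrMr; last lra.
rewrite mulrAC ler_pdivlMr; last lra.
rewrite -mulrA [leRHS]mulrC -mulrA ler_wpM2l//; nra.
Qed.

End dyadic_sums.

(** * Integrability of the maximal function *)

Section Psi_loglog.
Context {R : realType} {n : nat}.
Local Notation E := 'rV[R]_n.+1.
Local Notation X := (lebesgue_rV R n).
Local Notation mu := (@lebesgue_measure_rV R n).
Local Open Scope ereal_scope.
Implicit Types (x : E) (t : R).

Lemma indic_superlevel (g : E -> R) t x :
  \1_(superlevel g t) x = (t < g x)%R%:R :> R.
Proof. by rewrite indicE; congr (_%:R); congr nat_of_bool; apply/idP/idP; rewrite inE. Qed.

Lemma indic_superlevel_fine (h : E -> \bar R) t x : h x \is a fin_num ->
  \1_[set x | t%:E < h x] x = (t < fine (h x))%R%:R :> R.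
Proof.
move=> hx; rewrite indicE; congr (_%:R); congr nat_of_bool.
by rewrite -lte_fin fineK//; apply/idP/idP; rewrite inE.
Qed.

Variables (g : E -> R) (c : E) (r : R).
Hypotheses (mg : measurable_fun [set: X] (g : X -> R)) (g0 : forall x, (0 <= g x)%R).
Hypothesis r0 : (0 < r)%R.
Let B : set X := closed_eball c r.
Hypothesis gB : forall x, ~ B x -> g x = 0%R.
Hypothesis g_fin : \int[mu]_(x in (B : set X)) (g x)%:E < +oo.

Let mB : measurable B. Proof. exact: measurable_closed_eball. Qed.

Let setT_B (h : X -> \bar R) : (forall x, ~ B x -> h x = 0) ->
  \int[mu]_x h x = \int[mu]_(x in B) h x.
Proof.
move=> hB; rewrite [RHS]integral_mkcond; apply: eq_integral => x _.
by rewrite patchE; case: ifPn => // /negP xB; apply: hB => Bx; apply: xB; rewrite inE.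
Qed.

Let gT_fin : \int[mu]_(x in [set: X]) (g x)%:E < +oo.
Proof. by rewrite setT_B// => x /gB ->. Qed.

Let Mg := average_sup g.
Let mMg : measurable_fun [set: X] (Mg : X -> \bar R).
Proof. exact: measurable_average_sup. Qed.

Let A t : set X := [set x : X | t%:E < Mg x].

Let mA t : measurable (A t).
Proof. exact: measurable_superlevel_average_sup. Qed.

Let indicA t x : Mg x \is a fin_num ->
  \1_(A t) x = (t < fine (Mg x))%R%:R :> R.
Proof. exact: indic_superlevel_fine. Qed.

Let mgB (D : set X) : measurable_fun D (fun x : X => (g x)%:E).
Proof. by apply/measurable_EFinP; exact: measurable_funS mg. Qed.

Let mtr (D : set X) t : measurable_fun D (fun x : X => (truncate g t x)%:E).
Proof. by apply/measurable_EFinP; apply: measurable_funS (measurable_truncate mg t). Qed.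

Lemma average_sup_ge0 x : 0 <= Mg x.
Proof.
apply: (@le_trans _ _ ((mu (open_eball x 1%R))^-1 *
    \int[mu]_(y in (open_eball x 1%R : set X)) (g y)%:E)).
  rewrite mule_ge0 ?inve_ge0 ?outer_measure_ge0// integral_ge0// => y _.
  by rewrite lee_fin.
by apply: ereal_sup_ubound; exists 1%R => //=.
Qed.

Let Q x : R := Psi x (fine `|Mg x|).

Let Q_ge0 x : (0 <= Q x)%R.
Proof.
rewrite /Q /Psi divr_ge0 ?fine_ge0// addr_ge0//.
- by apply: le_trans (ln_expR1D_ge1 _) => //; rewrite fine_ge0.
- by apply: le_trans (ln_expR1D_ge1 _) => //; rewrite enorm_ge0.
Qed.

Let mQ : measurable_fun [set: X] (Q : X -> R).
Proof.
pose T x : R := fine `|Mg x|; pose den x : R := (ln (expR 1 + T x) + ln (expR 1 + enorm x))%R.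
have mT : measurable_fun [set: X] (T : X -> R).
  apply: (measurableT_comp (f := @fine R)); first exact: fine_measurable.
  by apply: (measurableT_comp (f := @abse R)); [exact: abse_measurable|exact: mMg].
have mlnD (h : X -> R) : measurable_fun [set: X] h ->
    measurable_fun [set: X] (fun x => ln (expR 1 + h x)%R).
  move=> mh; apply: (measurableT_comp (f := @ln R)); first exact: measurable_ln.
  by apply: measurable_funD; [exact: measurable_cst|exact: mh].
have men : measurable_fun [set: X] (fun x : X => enorm (x : E)).
  have := @measurable_enorm R n 0%R; congr measurable_fun.
  by apply/funext => x; rewrite subr0.
have mden : measurable_fun [set: X] (den : X -> R).
  by apply: measurable_funD; [exact: (mlnD _ mT)|exact: (mlnD _ men)].
(* The denominator is positive, so its inverse is [expR (- ln den)], a composition of measurable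
   functions. *)
rewrite (_ : Q = fun x => T x * expR (- ln (den x)))%R; last first.
  apply/funext => x; rewrite /Q /Psi expRN lnK// posrE.
  have := @ln_expR1D_ge1 R (T x); have := ln_expR1D_ge1 (enorm_ge0 x).
  by rewrite /den fine_ge0// => h /(_ isT); move: h; lra.
apply: measurable_funM; first exact: mT.
apply: (measurableT_comp (f := @expR R)); first exact: measurable_expR.
apply: (measurableT_comp (f := @GRing.opp R)); first exact: oppr_measurable.
by apply: (measurableT_comp (f := @ln R)); [exact: measurable_ln|exact: mden].
Qed.

Let mQE (D : set X) : measurable_fun D (fun x : X => (Q x)%:E).
Proof. by apply/measurable_EFinP; apply: measurable_funS mQ. Qed.

Let G x : R := (g x * logp (logp (g x)))%R.

Let G_ge0 x : (0 <= G x)%R. Proof. by rewrite mulr_ge0// logp_ge0. Qed.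

Let mG : measurable_fun [set: X] (G : X -> R).
Proof.
have mlogp (h : X -> R) : measurable_fun [set: X] h ->
    measurable_fun [set: X] (fun x => logp (h x)).
  move=> mh; have mln : measurable_fun [set: X] (fun x => ln `|h x|%R).
    apply: (measurableT_comp (f := @ln R)); first exact: measurable_ln.
    by apply: (measurableT_comp (f := @Num.norm R R)); [exact: normr_measurable|exact: mh].
  by apply: measurable_maxr; [exact: mln|exact: measurable_cst].
by apply: measurable_funM; [exact: mg|exact: (mlogp _ (mlogp _ mg))].
Qed.

Let mGE (D : set X) : measurable_fun D (fun x : X => (G x)%:E).
Proof. by apply/measurable_EFinP; apply: measurable_funS mG. Qed.

Let integral_sum_superlevel (u v : nat -> R) : (forall k, 0 <= u k)%R ->
  \int[mu]_(x in B) (\sum_(k <oo) (u k * \1_(A (v k)) x)%:E) =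
  \sum_(k <oo) (u k)%:E * mu (B `&` A (v k)).
Proof.
move=> u0; have mI k : measurable_fun B
    (fun x : X => (\1_(A (v k)) x)%:E : \bar R).
  by apply/measurable_EFinP; apply: measurable_indic; exact: mA.
rewrite integral_nneseries.
- apply: eq_eseriesr => k _; under eq_integral do rewrite EFinM.
  rewrite ge0_integralZl_EFin; [|exact: mB|by move=> x _; rewrite lee_fin|exact: mI|exact: u0].
  rewrite integral_indic; [|exact: mB|exact: mA].
  by rewrite setIC.
- exact: mB.
- move=> k; under eq_fun do rewrite EFinM.
  by apply: emeasurable_funM; [exact: measurable_cst|exact: mI].
- by move=> k x _; rewrite lee_fin mulr_ge0.
Qed.

Let integral_sum_truncate (u v : nat -> R) : (forall k, 0 <= u k)%R ->
  \int[mu]_(x in B) (\sum_(k <oo) (u k * truncate g (v k) x)%:E) =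
  \sum_(k <oo) (u k)%:E * \int[mu]_(x in B) (truncate g (v k) x)%:E.
Proof.
move=> u0; rewrite integral_nneseries.
- apply: eq_eseriesr => k _; under eq_integral do rewrite EFinM.
  rewrite ge0_integralZl_EFin; [by []|exact: mB| |exact: mtr|exact: u0].
  by move=> x _; rewrite lee_fin truncate_ge0.
- exact: mB.
- move=> k; under eq_fun do rewrite EFinM.
  by apply: emeasurable_funM; [exact: measurable_cst|exact: mtr].
- by move=> k x _; rewrite lee_fin mulr_ge0// truncate_ge0.
Qed.

Let mul_sum (a : R) (u : nat -> R) : (0 <= a)%R -> (forall k, 0 <= u k)%R ->
  a%:E * \sum_(k <oo) (u k)%:E = \sum_(k <oo) (a * u k)%:E.
Proof.
move=> a0 u0; rewrite -nneseriesZl; last by move=> k _; rewrite lee_fin.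
by apply: eq_eseriesr => k _; rewrite EFinM.
Qed.

Lemma Psi_of_loglog : \int[mu]_(x in B) (G x)%:E < +oo ->
  \int[mu]_(x in B) (Q x)%:E < +oo.
Proof.
move=> Gfin; have [C C0 weak] := weak_type mg g0 gT_fin.
set a := (_ / _)%R in weak.
have a0 : (0 < a)%R by rewrite divr_gt0 ?mulr_gt0 ?eballc_gt0 ?ballc_gt0.
have [C' C'0 sumC'] := sum_harmonic_le_loglog a0.
pose u k : R := (2 ^+ k.+3 / k.+1%:R)%R; pose w k : R := (k.+1%:R^-1)%R.
have u0 k : (0 <= u k)%R by rewrite divr_ge0// exprn_ge0.
have w0 k : (0 <= w k)%R by rewrite invr_ge0.
have p0 k : (0 < 2 ^+ k.+1 :> R)%R by rewrite exprn_gt0.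
pose S x : \bar R := \sum_(k <oo) (u k * \1_(A (2 ^+ k.+1)) x)%:E.
have S0 x : 0 <= S x by apply: nneseries_ge0 => k _ _; rewrite lee_fin mulr_ge0.
have mS : measurable_fun B (S : X -> \bar R).
  apply: emeasurable_nneseries => [k x|k]; first by rewrite lee_fin mulr_ge0.
  apply/measurable_EFinP/measurable_funM; first exact: measurable_cst.
  by apply: measurable_indic; exact: mA.
have QS : \int[mu]_(x in B) (Q x)%:E <= 2%:E * mu B + \int[mu]_(x in B) S x.
  rewrite -[2%:E * _](integral_cst mu mB) -ge0_integralD; last first.
  - exact: mS.
  - by move=> x _; exact: S0.
  - exact: measurable_cst.
  - by move=> x _; rewrite lee_fin.
  - exact: mB.
  apply: ge0_le_integral.
  - exact: mB.
  - by move=> x _; rewrite lee_fin.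
  - exact: mQE.
  - by apply: emeasurable_funD; [exact: measurable_cst|exact: mS].
  move=> x _; apply: le_trans (Psi_le_sum _ _) _; first exact: fine_ge0.
  apply: leeD; first exact: lexx.
  apply: lee_nneseries => [k _ _|k _]; first by rewrite lee_fin mulr_ge0.
  rewrite lee_fin ler_wpM2l//; have [Mfin|Minf] := boolP (Mg x \is a fin_num).
    by rewrite indicA// gee0_abs// average_sup_ge0.
  (* Where the maximal function is infinite, [fine] returns [0] and no level is counted on the
     left. *)
  have -> : fine `|Mg x| = 0%R by case: (Mg x) Minf.
  by rewrite ltNge (ltW (p0 k)).
apply: le_lt_trans QS _; rewrite lte_add_pinfty//.
  by rewrite lte_mul_pinfty// mu_closed_eball_fin.
rewrite /S integral_sum_superlevel//.
apply: (@le_lt_trans _ _ ((4 * C)%:E * \int[mu]_(x in B)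
    \sum_(k <oo) (w k * truncate g (a * 2 ^+ k.+1) x)%:E)).
  rewrite integral_sum_truncate// -nneseriesZl; last first.
    move=> k _; apply: mule_ge0; first by rewrite lee_fin.
    by apply: integral_ge0 => x _; rewrite lee_fin truncate_ge0.
  apply: lee_nneseries => [k _ _|k _].
    by apply: mule_ge0; [rewrite lee_fin|exact: outer_measure_ge0].
  apply: (@le_trans _ _ ((u k)%:E * ((C / 2 ^+ k.+1)%:E *
      \int[mu]_x (truncate g (a * 2 ^+ k.+1) x)%:E))).
    rewrite lee_wpmul2l ?lee_fin//; apply: le_trans (weak _ (p0 k)).
    by apply: le_outer_measure => x [].
  rewrite setT_B; last by move=> x /gB gx; rewrite /truncate gx mul0r.
  (* The factor [1 / 2 ^ (k + 1)] of the weak-type bound cancels the power in [u k] up to [4] and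
     leaves the harmonic weight. *)
  rewrite !muleA -!EFinM (_ : u k * (C / 2 ^+ k.+1) = 4 * C * w k)%R; first exact: lexx.
  rewrite /u /w (exprS _ k.+2) (exprS _ k.+1).
  by move: (2 ^+ k.+1)%R (p0 k) (k.+1%:R^-1)%R => y y0 z; field; rewrite gt_eqF.
rewrite lte_mul_pinfty//; first by rewrite lee_fin mulr_ge0// ltW.
apply: (@le_lt_trans _ _ (\int[mu]_(x in B) (C'%:E * (g x)%:E + 2%:E * (G x)%:E))).
  apply: ge0_le_integral.
  - exact: mB.
  - by move=> x _; apply: nneseries_ge0 => k _ _; rewrite lee_fin mulr_ge0// truncate_ge0.
  - apply: emeasurable_nneseries => [k x|k]; first by rewrite lee_fin mulr_ge0// truncate_ge0.
    under eq_fun do rewrite EFinM.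
    by apply: emeasurable_funM; [exact: measurable_cst|exact: mtr].
  - apply: emeasurable_funD; apply: emeasurable_funM; [exact: measurable_cst|exact: mgB|
      exact: measurable_cst|exact: mGE].
  move=> x _; have := sumC' _ (g0 x).
  have gx0 : 0 <= (g x)%:E by rewrite lee_fin.
  move=> /(lee_wpmul2l gx0); rewrite mul_sum//.
  move=> h; apply: (@le_trans _ _ ((g x)%:E * (C' + 2 * logp (logp (g x)))%:E)).
    apply: le_trans h; apply: lee_nneseries => [k _ _|k _].
      by rewrite lee_fin mulr_ge0// truncate_ge0.
    by rewrite /truncate indic_superlevel lee_fin mulrCA.
  by rewrite -!EFinM -EFinD lee_fin /G le_eqVlt; apply/orP; left; apply/eqP; ring.
rewrite ge0_integralD; last first.
- by apply: emeasurable_funM; [exact: measurable_cst|exact: mGE].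
- by move=> x _; rewrite -EFinM lee_fin mulr_ge0.
- by apply: emeasurable_funM; [exact: measurable_cst|exact: mgB].
- by move=> x _; rewrite -EFinM lee_fin mulr_ge0// ltW.
- exact: mB.
rewrite ge0_integralZl_EFin; [|exact: mB|by move=> x _; rewrite lee_fin|exact: mgB|exact: ltW].
rewrite ge0_integralZl_EFin; [|exact: mB|by move=> x _; rewrite lee_fin|exact: mGE|by []].
rewrite lte_add_pinfty// lte_mul_pinfty//; rewrite lee_fin ltW//.
Qed.

Lemma loglog_of_Psi : {ae mu, forall x : X, B x -> Mg x \is a fin_num} ->
  \int[mu]_(x in B) (Q x)%:E < +oo -> \int[mu]_(x in B) (G x)%:E < +oo.
Proof.
move=> Mfin Qfin.
have [C [l [t0 [C0 l01 weak]]]] := reverse_weak_type mg g0 gT_fin r0 gB.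
have l0 : (0 < l)%R by case/andP: l01.
(* For [k >= m] the level [2 ^ (k + 1)] is at least [t0]; the weights [wm] vanish on the lower
   levels. *)
pose m := (Num.truncn t0).+1.
have t0m : (t0 <= m%:R)%R by apply: ltW; exact: truncnS_gt.
pose w k : R := (k.+1%:R^-1)%R; pose u k : R := (2 ^+ k.+1 / k.+1%:R)%R.
pose wm k : R := (w k * (m <= k)%N%:R)%R.
have w0 k : (0 <= w k)%R by rewrite invr_ge0.
have wm0 k : (0 <= wm k)%R by rewrite mulr_ge0.
have u0 k : (0 <= u k)%R by rewrite divr_ge0// exprn_ge0.
have p0 k : (0 < 2 ^+ k.+1 :> R)%R by rewrite exprn_gt0.
pose S x : \bar R := \sum_(k <oo) (wm k * truncate g (2 ^+ k.+1) x)%:E.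
have S0 x : 0 <= S x.
  by apply: nneseries_ge0 => k _ _; rewrite lee_fin mulr_ge0// truncate_ge0.
have mS : measurable_fun B (S : X -> \bar R).
  apply: emeasurable_nneseries => [k x|k]; first by rewrite lee_fin mulr_ge0// truncate_ge0.
  under eq_fun do rewrite EFinM.
  by apply: emeasurable_funM; [exact: measurable_cst|exact: mtr].
have mmg : measurable_fun B (fun x : X => m%:R%:E * (g x)%:E).
  by apply: emeasurable_funM; [exact: measurable_cst|exact: mgB].
have GS : \int[mu]_(x in B) (G x)%:E <=
    m%:R%:E * \int[mu]_(x in B) (g x)%:E + \int[mu]_(x in B) S x.
  rewrite -ge0_integralZl_EFin; [|exact: mB|by move=> x _; rewrite lee_fin|exact: mgB|by []].
  rewrite -ge0_integralD; [|exact: mB| |exact: mmg|by move=> x _; exact: S0|exact: mS]; last first.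
    by move=> x _; rewrite -EFinM lee_fin mulr_ge0.
  apply: ge0_le_integral.
  - exact: mB.
  - by move=> x _; rewrite lee_fin.
  - exact: mGE.
  - by apply: emeasurable_funD; [exact: mmg|exact: mS].
  move=> x _; have := loglog_le_sum_harmonic m (g0 x).
  have gx0 : 0 <= (g x)%:E by rewrite lee_fin.
  move=> /(lee_wpmul2l gx0); rewrite -EFinM -/(G x) => h; apply: le_trans h _.
  rewrite ge0_muleDr; [|by rewrite lee_fin|]; last first.
    by apply: nneseries_ge0 => k _ _; rewrite lee_fin mulr_ge0.
  rewrite mul_sum; [|by []|by move=> k; rewrite mulr_ge0].
  rewrite muleC; apply: leeD; first exact: lexx.
  apply: lee_nneseries => [k _ _|k _]; first by rewrite lee_fin !mulr_ge0.
  rewrite lee_fin /wm /truncate indic_superlevel le_eqVlt; apply/orP; left; apply/eqP.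
  by case: leqP => _ /=; rewrite ?mulr0 ?mulr1 ?mul0r ?mulr0// mulrCA.
apply: le_lt_trans GS _; rewrite lte_add_pinfty//; first by rewrite lte_mul_pinfty// lee_fin.
rewrite /S integral_sum_truncate//.
apply: (@le_lt_trans _ _ (C%:E * \int[mu]_(x in B)
    \sum_(k <oo) (u k * \1_(A (l * 2 ^+ k.+1)) x)%:E)).
  rewrite (integral_sum_superlevel (fun k => l * 2 ^+ k.+1)%R u0) -nneseriesZl; last first.
    by move=> k _; apply: mule_ge0; [rewrite lee_fin|exact: outer_measure_ge0].
  apply: lee_nneseries => [k _ _|k _].
    apply: mule_ge0; first by rewrite lee_fin.
    by apply: integral_ge0 => x _; rewrite lee_fin truncate_ge0.
  have [mk|km] := leqP m k; last first.
    rewrite /wm leqNgt km mulr0 mul0e; apply: mule_ge0; first by rewrite lee_fin ltW.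
    by apply: mule_ge0; [rewrite lee_fin|exact: outer_measure_ge0].
  have t0k : (t0 <= 2 ^+ k.+1)%R.
    apply: le_trans t0m _; rewrite -natrX ler_nat; apply: leq_trans mk _.
    by apply: ltnW; apply: ltn_trans (ltnSn k) _; exact: ltn_expl.
  have := weak _ (p0 k) t0k; rewrite setT_B; last first.
    by move=> x /gB gx; rewrite /truncate gx mul0r.
  have wk : 0 <= (w k)%:E by rewrite lee_fin.
  move=> /(lee_wpmul2l wk) h; rewrite /wm mk mulr1; apply: le_trans h _.
  rewrite !muleA -!EFinM (_ : w k * (C * 2 ^+ k.+1) = C * u k)%R; first exact: lexx.
  by rewrite /w /u; ring.
rewrite lte_mul_pinfty//; first by rewrite lee_fin ltW.
pose M := ln (expR 1 + (enorm c + r)).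
have en x : B x -> (ln (expR 1 + enorm x) <= M)%R.
  move=> Bx; have e1 := @expR_gt0 R 1; have ex := enorm_ge0 x; have ec := enorm_ge0 c.
  rewrite ler_ln ?posrE; [|lra|by move: r0; lra].
  rewrite lerD2l -{1}(subrK c x) addrC; apply: le_trans (ler_enormD _ _) _.
  by rewrite lerD2l.
have M0 : (0 <= M)%R.
  by apply: le_trans (@ln_expR1D_ge1 R (enorm c + r) _) => //; rewrite addr_ge0 ?enorm_ge0 ?ltW.
pose K := (16 / l * (1 + M))%R.
have K0 : (0 <= K)%R by rewrite mulr_ge0 ?addr_ge0// divr_ge0// ltW.
apply: (@le_lt_trans _ _ (\int[mu]_(x in B) (K%:E * (Q x)%:E))); last first.
  rewrite ge0_integralZl_EFin; [|exact: mB|by move=> x _; rewrite lee_fin|exact: mQE|by []].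
  by rewrite lte_mul_pinfty// lee_fin.
(* The pointwise bound fails where the maximal function is infinite: there the sum on the left
   diverges while [Q] is [0]. *)
apply: ae_ge0_le_integral.
- exact: mB.
- by move=> x _; apply: nneseries_ge0 => k _ _; rewrite lee_fin mulr_ge0.
- apply: emeasurable_nneseries => [k x|k]; first by rewrite lee_fin mulr_ge0.
  apply/measurable_EFinP/measurable_funM; first exact: measurable_cst.
  by apply: measurable_indic; exact: mA.
- by move=> x _; rewrite -EFinM lee_fin mulr_ge0.
- by apply: emeasurable_funM; [exact: measurable_cst|exact: mQE].
apply: filterS Mfin => x Mx Bx; have {}Mx := Mx Bx.
have T0 : (0 <= fine (Mg x))%R by rewrite fine_ge0// average_sup_ge0.
under eq_eseriesr do rewrite indicA//.
apply: le_trans (sum_exp2_div_le_log l01 T0) _.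
rewrite -EFinM lee_fin /K -[leRHS]mulrA ler_wpM2l//; first by rewrite divr_ge0// ltW.
by rewrite /Q gee0_abs ?average_sup_ge0//; apply: le_Psi => //; exact: en.
Qed.

(** The weak-type estimate bounds the measure of the set of infinite values by a constant over [t],
    for every [t]. *)
Lemma average_sup_ae_fin : {ae mu, forall x : X, B x -> Mg x \is a fin_num}.
Proof.
have [C C0 weak] := weak_type mg g0 gT_fin.
pose I := \int[mu]_(x in [set: X]) (g x)%:E.
have I0 : 0 <= I by apply: integral_ge0 => x _; rewrite lee_fin.
have Ifin : I \is a fin_num by rewrite ge0_fin_numE.
pose N : set X := [set x | Mg x = +oo].
have NI t : (0 < t)%R -> mu N <= (C * fine I / t)%:E.
  move=> t0; apply: (@le_trans _ _ ((C / t)%:E * I)); last first.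
    by rewrite -(fineK Ifin) -EFinM lee_fin mulrAC.
  apply: (@le_trans _ _ (mu (A t))).
    by apply: le_outer_measure => x Nx; rewrite /A /= Nx ltry.
  have Ct0 : 0 <= (C / t)%:E by rewrite lee_fin divr_ge0// ltW.
  apply: le_trans (weak _ t0) _; apply: lee_wpmul2l; first exact: Ct0.
  apply: ge0_le_integral.
  - exact: measurableT.
  - by move=> x _; rewrite lee_fin truncate_ge0.
  - exact: mtr.
  - exact: mgB.
  by move=> x _; rewrite lee_fin /truncate indicE ler_piMr// lern1 leq_b1.
have N0 : mu N = 0.
  apply/eqP; rewrite eq_le outer_measure_ge0 andbT.
  apply/lee_addgt0Pr => e e0; rewrite add0e.
  have CI0 : (0 <= C * fine I)%R by rewrite mulr_ge0 ?fine_ge0// ltW.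
  have t0 : (0 < (C * fine I + 1) / e)%R by rewrite divr_gt0// ltr_wpDl.
  apply: le_trans (NI _ t0) _; rewrite lee_fin invf_div mulrA ler_pdivrMr ?ltr_wpDl//.
  by rewrite mulrDr mulr1 [leRHS]addrC mulrC lerDr ltW.
exists N; split; [exact: null_measurable_rV|exact: N0|].
move=> x /= h; rewrite /N/=; apply: contrapT => /eqP Noo; apply: h => _.
by rewrite ge0_fin_numE ?average_sup_ge0// lt_neqAle Noo leey.
Qed.

End Psi_loglog.

(** * Local integrability of functions supported in a ball *)

Section local_integrability.
Context {R : realType} {n : nat}.
Local Notation E := 'rV[R]_n.+1.
Local Notation X := (lebesgue_rV R n).
Local Notation mu := (@lebesgue_measure_rV R n).
Local Open Scope ereal_scope.
Implicit Types (f : E -> R[i]) (x c : E) (r : R).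

Lemma compact_measurable_rV (K : set E) : compact K -> measurable (K : set X).
Proof.
move=> cK; have /closed_openC/(@open_measurable_rV R n)/measurableC : closed K.
  by apply: compact_closed cK; exact: norm_hausdorff.
by rewrite setCK.
Qed.

Lemma closed_eball_sub_compact c r : exists2 K : set E, compact K & closed_eball c r `<=` K.
Proof.
exists [set v : E | forall i, `[(c 0 i - r)%R, (c 0 i + r)%R]%classic (v ord0 i)].
  by apply: (@rV_compact R n.+1 (fun i => `[(c 0 i - r)%R, (c 0 i + r)%R]%classic)) => i;
    exact: segment_compact.
move=> x xr i /=; rewrite in_itv/= -ler_distlC.
rewrite distrC; apply: le_trans xr; have := coord_le_enorm (x - c) i.
by rewrite !mxE.
Qed.

Lemma cabs_ge0 f x : (0 <= cabs f x)%R.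
Proof. by rewrite /cabs; case: (f x) => a b; exact: sqrtr_ge0. Qed.

Lemma measurable_cabs f : cmeasurable f ->
  measurable_fun [set: X] (cabs f : X -> R).
Proof.
move=> [mRe mIm].
rewrite (_ : cabs f = fun x => Num.sqrt (complex.Re (f x) ^+ 2 + complex.Im (f x) ^+ 2)%R).
  apply: (measurableT_comp (f := @Num.sqrt R)).
    by apply: continuous_measurable_fun; exact: sqrt_continuous.
  by apply: measurable_funD; apply: measurable_funX; [exact: mRe|exact: mIm].
by apply/funext => x; rewrite /cabs; case: (f x).
Qed.

Lemma cabs_eq0 f (B : set E) : supp f `<=` B -> forall x, ~ B x -> cabs f x = 0%R.
Proof.
move=> fB x nBx; have [fx0|fx0] := eqVneq (f x) 0%R.
  by rewrite /cabs fx0 Normc.normc0.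
by exfalso; apply: nBx; apply: fB; exact: subset_closure.
Qed.

Lemma clocally_integrableP f c r : cmeasurable f -> supp f `<=` closed_eball c r ->
  clocally_integrable f <->
  \int[mu]_(x in (closed_eball c r : set X)) (cabs f x)%:E < +oo.
Proof.
move=> mf fB; have mB := @measurable_closed_eball R n c r.
have mg D : measurable_fun (D : set X) (fun x : X => (cabs f x)%:E).
  by apply/measurable_EFinP; exact: measurable_funS (measurable_cabs mf).
split=> [[_ fint]|Bfin].
  have [K cK BK] := closed_eball_sub_compact c r.
  apply: le_lt_trans (fint _ cK); apply: ge0_subset_integral.
  - exact: mB.
  - exact: compact_measurable_rV.
  - exact: mg.
  - by move=> x _; rewrite lee_fin cabs_ge0.
  - exact: BK.
split=> // K cK; apply: le_lt_trans Bfin.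
rewrite integral_mkcond [leRHS]integral_mkcond.
have mK : measurable (K : set X) by exact: compact_measurable_rV.
apply: ge0_le_integral.
- exact: measurableT.
- by move=> x _; apply: erestrict_ge0 => y _; rewrite lee_fin cabs_ge0.
- by apply/(measurable_restrictT _ mK); exact: mg.
- by apply/(measurable_restrictT _ mB); exact: mg.
move=> x _; rewrite !patchE; case: ifPn => _; case: ifPn => xB.
- exact: lexx.
- rewrite (cabs_eq0 fB) ?lexx// => Bx; by move/negP: xB; apply; rewrite inE.
- by rewrite lee_fin cabs_ge0.
- exact: lexx.
Qed.

(** The ball of radius [2 * r + 1] about [x] contains the whole closed ball, and an infinite
    integral over it would make the average at [x] infinite. *)
Lemma integrable_of_average_sup_fin (g : E -> R) c r x :
  measurable_fun [set: X] (g : X -> R) -> (forall y, (0 <= g y)%R) ->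
  (0 < r)%R -> closed_eball c r x -> average_sup g x \is a fin_num ->
  \int[mu]_(y in (closed_eball c r : set X)) (g y)%:E < +oo.
Proof.
move=> mg g0 r0 xr Mfin; set s := (2 * r + 1)%R.
have s0 : (0 < s)%R by rewrite /s; lra.
apply: (@le_lt_trans _ _ (\int[mu]_(y in (open_eball x s : set X)) (g y)%:E)).
  apply: ge0_subset_integral.
  - exact: measurable_closed_eball.
  - exact: measurable_eball.
  - by apply/measurable_EFinP; exact: measurable_funS mg.
  - by move=> y _; rewrite lee_fin.
  move=> y yr; rewrite /open_eball/= (_ : y - x = (y - c) + - (x - c))%R; last first.
    by rewrite opprB addrA subrK.
  apply: le_lt_trans (ler_enormD _ _) _; rewrite enormN.
  by move: xr yr; rewrite /closed_eball/= /s; lra.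
rewrite ltNge; apply/negP => Iy.
have /lt_average_supP : exists2 r, (0 < r)%R &
    (fine (average_sup g x) * @eballc R n * r ^+ n.+1)%:E <
    \int[mu]_(y in (open_eball x r : set X)) (g y)%:E.
  by exists s => //; apply: lt_le_trans Iy; rewrite ltry.
by rewrite fineK// ltxx.
Qed.

End local_integrability.

Theorem theorem2 (R : realType) (n : nat) (f : 'rV[R]_n.+1 -> R[i])
    (B : set 'rV[R]_n.+1) (c : 'rV[R]_n.+1) (r : R)
    (hr : 0 < r) (hB : B = closed_eball c r) (hBproper : B `<` [set: 'rV[R]_n.+1])
    (hfmeas : cmeasurable f) (hfsupp : supp f `<=` B) :
  L_Psi B (maximal f) <-> LloglogL B f.
Proof.
subst B; have mg := measurable_cabs hfmeas; have g0 := cabs_ge0 f.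
have gB := cabs_eq0 hfsupp.
have mB : measurable (closed_eball c r : set (lebesgue_rV R n)).
  exact: measurable_closed_eball.
split=> [[_ Mfin Mint]|[/(clocally_integrableP hfmeas hfsupp) gfin _ gloglog]]; last first.
  split.
  - exact: measurable_funS (measurable_average_sup mg g0).
  - exact: average_sup_ae_fin.
  - exact: Psi_of_loglog.
(* The ball has positive measure, so the almost everywhere finiteness in [L_Psi] provides a point;
   it yields the integrability on which the reverse estimate depends. *)
have [x Bx xfin] : exists2 x, closed_eball c r x & average_sup (cabs f) x \is a fin_num.
  apply: contrapT => nx.
  have /negligibleP : (@lebesgue_measure_rV R n).-negligible
      (closed_eball c r : set (lebesgue_rV R n)).
    by apply: negligibleS Mfin => y By /(_ By) yfin; apply: nx; exists y.
  move=> /(_ mB) B0; have : (lebesgue_measure_rV (open_eball c r) <= 0)%E.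
    by rewrite -B0; apply: le_outer_measure => y /ltW.
  by rewrite mu_eball// lee_fin leNgt mulr_gt0 ?eballc_gt0 ?exprn_gt0.
have gfin := integrable_of_average_sup_fin mg g0 hr Bx xfin.
split=> //; first exact/(clocally_integrableP hfmeas hfsupp).
exact: loglog_of_Psi.
Qed.
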